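(* Assume the narrow class number of $F$ is $1$ and let $\delta$ be a totally positive generator of the different $\mathfrak{d}$. Let $k>2$ be even, $\mathfrak{n}$ a nonzero integral ideal, $\mu\in(\mathfrak{d}^{-1})^+$, $\alpha\in\mathcal{O}^+$, and $p$ a totally positive prime element such that the ideal $(\alpha p)$ is coprime to the ideal $\mu\delta\mathfrak{n}$. Then: (1) If $P'_\mu(z;k,\mathfrak{n})\equiv0$, then $P'_{\mu\alpha}(z;k,\mathfrak{n})\equiv0$. (2) If $P'_\mu(z;k,\mathfrak{n})\not\equiv0$, then for every positive integer $m$, either $P'_{\mu p^m}(z;k,\mathfrak{n})\not\equiv0$, or both $P'_{\mu p^{m-1}}(z;k,\mathfrak{n})\not\equiv0$ and $P'_{\mu p^{m+1}}(z;k,\mathfrak{n})\not\equiv0$.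
   Context: $F$ is a totally real number field of degree $n>1$ with ring of integers $\mathcal{O}$, different $\mathfrak{d}$, real embeddings $\sigma_i$, $a_i=\sigma_i(a)$; $S^+$ is the set of totally positive elements of $S\subset F$. A prime element is a generator of a nonzero prime ideal. Let $\Gamma=\Gamma_0(\mathfrak{n})=\{\begin{pmatrix}a&b\\c&d\end{pmatrix}\in\mathrm{SL}_2(\mathcal{O}): c\in\mathfrak{n}\}$ act componentwise on $\mathbb{H}^n$. With $N(cz+d)^k=\prod_i(c_iz_i+d_i)^k$ and $e(\mu w)=\exp(2\pi i\sum_i\mu_iw_i)$, for even $k>2$ and $\mu\in(\mathfrak{d}^{-1})^+$, $P'_\mu(z;k,\mathfrak{n})=\sum_{\gamma\in N(\Gamma)\backslash\Gamma}N(cz+d)^{-k}e(\mu\gamma z)$, where $N(\Gamma)=\{\begin{pmatrix}1&b\\0&1\end{pmatrix}:b\in\mathcal{O}\}$. *)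

(* Defs.v *)
From HB Require Import structures.
From mathcomp Require Import all_boot all_order all_algebra all_field.
From mathcomp Require Import all_classical all_reals all_analysis.
From mathcomp Require Import complex.
Set Implicit Arguments. Unset Strict Implicit. Unset Printing Implicit Defensive.
Import Order.TTheory GRing.Theory Num.Theory.
Local Open Scope ring_scope.
Local Open Scope classical_set_scope.

Section NumberField.
(* F : a number field (finite extension of Q); n : its degree;
   sigma : the family of (real) embeddings sigma_i : F -> R. *)
Variables (R : realType) (F : fieldExtType rat) (n : nat).
Variable sigma : 'I_n -> {rmorphism F -> R}.

Definition Ointeg : set F :=
  [set x | exists p : {poly int}, p \is monic /\ root (map_poly (fun z : int => z%:~R) p) x].

Definition totpos (x : F) : Prop := forall i, 0 < sigma i x.

Definition trace (x : F) : R := \sum_(i < n) sigma i x.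

Definition invdiff : set F :=
  [set x | forall y, Ointeg y -> exists z : int, trace (x * y) = z%:~R].

(* different d = (d^{-1})^{-1} = { x in F | x d^{-1} subset O } *)
Definition different : set F :=
  [set x | forall y, invdiff y -> Ointeg (x * y)].

Definition int_ideal (I : set F) : Prop :=
  [/\ I `<=` Ointeg, I 0,
      (forall x y, I x -> I y -> I (x + y)) &
      (forall a x, Ointeg a -> I x -> I (a * x))].

Definition nonzero_set (I : set F) : Prop := exists2 x, I x & x != 0.

Definition principal (g : F) : set F := [set x | exists2 y, Ointeg y & x = g * y].

Definition narrow_class_number_one : Prop :=
  forall I, int_ideal I -> nonzero_set I ->
    exists g, totpos g /\ I = principal g.

Definition prime_elt (p : F) : Prop :=
  [/\ Ointeg p, p != 0, ~ principal p 1 &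
      forall a b, Ointeg a -> Ointeg b -> principal p (a * b) ->
        principal p a \/ principal p b].

Definition coprime_ideals (I J : set F) : Prop :=
  exists a b, [/\ I a, J b & a + b = 1].

Definition Gamma0 (N : set F) : set 'M[F]_2 :=
  [set g : 'M[F]_2 | [/\ forall i j, Ointeg (g i j), \det g = 1 & N (g 1 0)]].

Definition NGamma : set 'M[F]_2 :=
  [set h : 'M[F]_2 | exists2 b, Ointeg b &
     h = \matrix_(i < 2, j < 2) (if i == j then 1 else if (i == 0) && (j == 1) then b else 0)].

Definition cosets (G : set 'M[F]_2) : set (set 'M[F]_2) :=
  [set C | exists2 g, G g & C = [set h *m g | h in NGamma]].

Local Notation C := R[i].
Local Open Scope complex_scope.

Definition Hn : set ('I_n -> C) := [set z | forall i, 0 < complex.Im (z i)].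

Definition act (g : 'M[F]_2) (z : 'I_n -> C) : 'I_n -> C := fun i =>
  ((sigma i (g 0 0))%:C * z i + (sigma i (g 0 1))%:C) /
  ((sigma i (g 1 0))%:C * z i + (sigma i (g 1 1))%:C).

(* exp(2 pi i w) *)
Definition e1 (w : C) : C :=
  Complex (expR (- (2 * pi) * complex.Im w) * cos (2 * pi * complex.Re w))
          (expR (- (2 * pi) * complex.Im w) * sin (2 * pi * complex.Re w)).

Definition e_mu (mu : F) (w : 'I_n -> C) : C :=
  e1 (\sum_(i < n) (sigma i mu)%:C * w i).

Definition Ncz_d (g : 'M[F]_2) (z : 'I_n -> C) (k : nat) : C :=
  \prod_(i < n) ((sigma i (g 1 0))%:C * z i + (sigma i (g 1 1))%:C) ^+ k.

Definition HasSum {I : choiceType} (D : set I) (f : I -> C) (s : C) : Prop :=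
  forall eps : C, 0 < eps -> exists A0 : set I,
    [/\ finite_set A0, A0 `<=` D &
        forall A : set I, finite_set A -> A0 `<=` A -> A `<=` D ->
          `| (\sum_(i \in A) f i) - s | < eps].

Definition fam_sum {I : choiceType} (D : set I) (f : I -> C) : C :=
  xget 0 [set s | HasSum D f s].

(* P'_mu(z; k, N) = sum_{gamma in N(Gamma)\Gamma} N(cz+d)^{-k} e(mu gamma z);
   each coset contributes the term of (any) representative. *)
Definition poincare (k : nat) (N : set F) (mu : F) (z : 'I_n -> C) : C :=
  fam_sum (cosets (Gamma0 N))
    (fun Cs => let g := xget 0 Cs in (Ncz_d g z k)^-1 * e_mu mu (act g z)).

Definition poincare_vanishes (k : nat) (N : set F) (mu : F) : Prop :=
  forall z, Hn z -> poincare k N mu z = 0.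

End NumberField.

(* Main.v *)
(** Write [T g = N(cz+d)^-k e(mu g z)].  For a totally positive prime element [p] coprime to [n],
    let [Delta] be the set of integral matrices of determinant [p] whose lower left entry lies
    in [n], and let [b] run over [diag(p, 1)] and [(1 r; 0 p)] with [r] modulo [p].  Summing [T]
    over [U \ Delta], with [U] the integral translations, in two ways, along [Delta = \bigcup Gamma b]
    and along [Delta = \bigcup U b Gamma], gives
      [P_mu(p z) + N(p)^-k sum_r P_mu((z + r) / p)
         = P_(mu p)(z) + N(p)^-k (sum_r e(mu r / p)) P_(mu / p)(z)].
    The character sum vanishes when [mu / p] is not in the inverse different, and is nonzero
    otherwise.  Hence if [P_mu] vanishes, so does [P_(mu p)] up to a nonzero multiple of
    [P_(mu / p)].  Part (2) follows by descent on [m], and part (1) by induction on the norm of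
    [alpha], peeling off prime factors; units only move [z], since [P_mu(e z) = P_(mu e)(z)].

    The rearrangement needs absolute convergence.  Since [x^-r exp(-A/x) <= K (1 + x)^-2], a term is
    at most a constant times [prod_i (1 + |c_i z_i + d_i|^2)^-2], which is summable over the whole
    lattice of pairs [(c, d)], units included. *)

Require Import Defs.
From HB Require Import structures.
From mathcomp Require Import all_boot all_order all_algebra all_field.
From mathcomp Require Import all_classical all_reals all_analysis.
From mathcomp Require Import complex.
From mathcomp Require Import ring lra zify.
Import Order.TTheory GRing.Theory Num.Theory.
Local Open Scope ring_scope.
Local Open Scope classical_set_scope.
Local Open Scope complex_scope.

(** * Unordered sums of complex families *)

Lemma finite_set_inj {T U : choiceType} (f : T -> U) (A : set T) :
  {in A &, injective f} -> finite_set (f @` A) -> finite_set A.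
Proof. by move=> /inj_card_eq/eq_finite_set ->. Qed.

Section UnorderedSums.
Variable R : realType.
Implicit Types (I J : choiceType).

Lemma eq_HasSum I (D : set I) (f g : I -> R[i]) s :
  (forall x, D x -> f x = g x) -> HasSum D f s -> HasSum D g s.
Proof.
move=> fg hf e e0; have [A0 [fA0 A0D h]] := hf e e0.
exists A0; split=> // A fA A0A AD.
have -> : \sum_(i \in A) g i = \sum_(i \in A) f i; last exact: h.
by apply: eq_fsbigr => i /set_mem /AD /fg.
Qed.

Lemma HasSum_unique I (D : set I) (f : I -> R[i]) s t :
  HasSum D f s -> HasSum D f t -> s = t.
Proof.
move=> hs ht; apply/eqP; rewrite -subr_eq0 -normr_le0.
apply: contraT; rewrite -real_ltNge ?normr_real ?real0// => d0.
have e0 : 0 < `|s - t| / 2%:R by rewrite divr_gt0// ltr0n.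
have [A [fA AD hA]] := hs _ e0.
have [B [fB BD hB]] := ht _ e0.
have fAB : finite_set (A `|` B) by rewrite finite_setU.
have ABD : A `|` B `<=` D by move=> x [/AD|/BD].
have h1 := hA _ fAB (@subsetUl _ A B) ABD.
have h2 := hB _ fAB (@subsetUr _ A B) ABD.
suff: `|s - t| < `|s - t| by rewrite ltxx.
set u := \sum_(i \in _) _ in h1 h2.
have -> : s - t = (u - t) - (u - s) by ring.
apply: (le_lt_trans (ler_normB _ _)).
have -> : `|u - t - (u - s)| = `|s - t| by congr `| _ |; ring.
by rewrite [X in _ < X]splitr; apply: ltrD.
Qed.

Lemma fam_sum_eq I (D : set I) (f : I -> R[i]) s :
  HasSum D f s -> fam_sum D f = s.
Proof.
move=> hs; rewrite /fam_sum.
have /(@xgetPex _ 0) h : exists t, [set t | HasSum D f t] t by exists s.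
exact: HasSum_unique h hs.
Qed.

Lemma HasSum_set0 I (f : I -> R[i]) : HasSum set0 f 0.
Proof.
move=> e e0; exists set0; split=> // A _ _; rewrite subset0 => ->.
by rewrite fsbig_set0 subrr normr0.
Qed.

Lemma HasSumD I (D : set I) (f g : I -> R[i]) s t :
  HasSum D f s -> HasSum D g t -> HasSum D (fun x => f x + g x) (s + t).
Proof.
move=> hs ht e e0; have e2 : 0 < e / 2%:R by rewrite divr_gt0// ltr0n.
have [A [fA AD hA]] := hs _ e2; have [B [fB BD hB]] := ht _ e2.
exists (A `|` B); split=> [||X fX ABX XD]; first by rewrite finite_setU.
  by move=> x [/AD|/BD].
rewrite fsbig_split//= opprD addrACA.
rewrite [e]splitr (le_lt_trans (ler_normD _ _))// ltrD//.
  by apply: hA => //; apply: subset_trans ABX; apply: subsetUl.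
by apply: hB => //; apply: subset_trans ABX; apply: subsetUr.
Qed.

Lemma HasSumZ I (D : set I) (f : I -> R[i]) c s :
  HasSum D f s -> HasSum D (fun x => c * f x) (c * s).
Proof.
have [->|c0] := eqVneq c 0.
  move=> _; apply: (@eq_HasSum _ _ (fun=> 0)) => [x _|]; first by rewrite mul0r.
  rewrite mul0r => e e0; exists set0; split=> // A _ _ _.
  by rewrite fsbig1// subrr normr0.
move=> hs e e0; have c0' : 0 < `|c| by rewrite normr_gt0.
have e2 : 0 < e / `|c| by rewrite divr_gt0.
have [A [fA AD hA]] := hs _ e2; exists A; split=> // X fX AX XD.
by rewrite -mulr_fsumr -mulrBr normrM mulrC -ltr_pdivlMr// hA.
Qed.

Lemma HasSumU I (A B : set I) (f : I -> R[i]) s t : A `&` B = set0 ->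
  HasSum A f s -> HasSum B f t -> HasSum (A `|` B) f (s + t).
Proof.
move=> AB0 hs ht e e0; have e2 : 0 < e / 2%:R by rewrite divr_gt0// ltr0n.
have [A0 [fA AD hA]] := hs _ e2; have [B0 [fB BD hB]] := ht _ e2.
exists (A0 `|` B0); split=> [||X fX ABX XD]; first by rewrite finite_setU.
  by move=> x [/AD|/BD]; [left|right].
have -> : X = (X `&` A) `|` (X `&` B) by rewrite -setIUr; apply/esym/setIidl.
rewrite fsbigU//=; last 3 first.
- by apply: sub_finite_set fX => x [].
- by apply: sub_finite_set fX => x [].
- by move=> x [] [_ xA] [_ xB]; have : (A `&` B) x by []; rewrite AB0.
rewrite opprD addrACA [e]splitr (le_lt_trans (ler_normD _ _))// ltrD//.
  apply: hA; [by apply: sub_finite_set fX => x []| |by move=> x []].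
  by move=> x A0x; split; [apply: ABX; left|exact: AD].
apply: hB; [by apply: sub_finite_set fX => x []| |by move=> x []].
by move=> x A0x; split; [apply: ABX; right|exact: BD].
Qed.

(** Finite index sets correspond under [h]: a finite [B] inside [E] pulls back to the finite set of
    points of [D] mapped into [B]. The quantifiers over finite sets then transfer in both
    directions. *)
Lemma HasSum_bij I J (D : set I) (E : set J) (h : I -> J) (f : J -> R[i]) s :
  set_bij D E h -> HasSum D (f \o h) s <-> HasSum E f s.
Proof.
case=> hE hinj hsurj.
have key (A : set I) : A `<=` D -> \sum_(j \in h @` A) f j = \sum_(i \in A) f (h i).
  move=> AD; rewrite fsbig_image// => x y /set_mem /AD xD /set_mem /AD yD.
  by apply: hinj; rewrite inE.
have hpre (B : set J) : B `<=` E -> h @` (D `&` h @^-1` B) = B.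
  move=> BE; apply/seteqP; split=> [_ [x [_ Bx] <-]//|y By].
  by have [x Dx xy] := hsurj _ (BE _ By); exists x => //; split => //; rewrite /preimage/= xy.
have fpre (B : set J) : finite_set B -> finite_set (D `&` h @^-1` B).
  move=> fB; apply: (@finite_set_inj _ _ h); last by apply: sub_finite_set fB => _ [x [_ Bx] <-].
  by move=> x y xA yA; have [Dx _] := set_mem xA; have [Dy _] := set_mem yA; apply: hinj; rewrite inE.
split=> hs e e0; have [A [fA AD hA]] := hs _ e0.
  exists (h @` A); split=> [||X fX AX XE]; first exact: finite_image.
    by move=> _ [x /AD Dx <-]; exact: hE.
  rewrite -(hpre X XE) key; last by move=> x [].
  apply: hA; [exact: fpre| |by move=> x []].
  by move=> x Ax; split; [exact: AD|apply: AX; exists x].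
exists (D `&` h @^-1` A); split=> [||X fX AX XE]; first exact: fpre.
  by move=> x [].
rewrite -key//; apply: hA; first exact: finite_image.
  by rewrite -{1}(hpre A AD); apply: image_subset.
by move=> _ [x /XE Dx <-]; exact: hE.
Qed.

(** Pairs serve as indices so that cosets together with a finite list of matrices form one index
    set, which [sum_double_cosets] matches bijectively with another set of cosets. *)
Lemma HasSum_seq I J (r : seq J) (D : set I) (f : I * J -> R[i]) (s : J -> R[i]) :
  uniq r -> (forall j, j \in r -> HasSum D (fun x => f (x, j)) (s j)) ->
  HasSum [set xj | D xj.1 /\ xj.2 \in r] f (\sum_(j <- r) s j).
Proof.
elim: r => [|j r IH] /=.
  move=> _ _; rewrite big_nil.
  have -> : [set xj : I * J | D xj.1 /\ xj.2 \in [::]] = set0.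
    by apply/seteqP; split=> // x [].
  exact: HasSum_set0.
move=> /andP[jr ur] h; rewrite big_cons.
have -> : [set xj : I * J | D xj.1 /\ xj.2 \in j :: r] =
  [set xj | D xj.1 /\ xj.2 = j] `|` [set xj | D xj.1 /\ xj.2 \in r].
  apply/seteqP; split=> -[x y] /=.
    by rewrite inE => -[Dx /orP[/eqP->|yr]]; [left|right].
  by case=> -[Dx]; rewrite inE => ->; rewrite ?eqxx ?orbT.
apply: HasSumU.
- by apply/seteqP; split=> // -[x y] [/= [_ ->] [_]]; rewrite (negbTE jr).
- have hb : set_bij D [set xj : I * J | D xj.1 /\ xj.2 = j] (fun x => (x, j)).
    split=> [x Dx//|x y _ _ [->]//|[x y] [/= Dx ->]].
    by exists x.
  by apply/(HasSum_bij _ _ _ _ _ f (s j) hb); apply: h; rewrite mem_head.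
- by apply: IH => // i ir; apply: h; rewrite inE ir orbT.
Qed.

(** The sum is the supremum of the finite partial sums, which grow with the index set because the
    terms are nonnegative. *)
Lemma HasSum_ge0 I (D : set I) (u : I -> R) (M : R) :
  (forall x, D x -> 0 <= u x) ->
  (forall A : set I, finite_set A -> A `<=` D -> \sum_(i \in A) u i <= M) ->
  exists s, HasSum D (fun x => (u x)%:C) s.
Proof.
move=> u0 hM.
pose S := [set v | exists A : set I, [/\ finite_set A, A `<=` D & v = \sum_(i \in A) u i]].
have hS : has_sup S.
  split; first by exists 0, set0; split=> //; rewrite fsbig_set0.
  by exists M => _ [A [fA AD ->]]; exact: hM.
exists (sup S)%:C => e e0.
have e0' : 0 < complex.Re e by move: e0; rewrite ltcE => /andP[].
have eE : e = (complex.Re e)%:C.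
  by move: e0; rewrite ltcE => /andP[/eqP ei _]; case: e {e0'} ei => a b /= ->.
have [_ [A [fA AD ->]] hA] := sup_adherent e0' hS.
exists A; split=> // X fX AX XD.
have -> : \sum_(i \in X) (u i)%:C = (\sum_(i \in X) u i)%:C.
  by rewrite !fsbig_finite//= raddf_sum.
rewrite -raddfB/= normc_def/= expr0n/= addr0 sqrtr_sqr eE ltcR ltr_norml.
have h1 : \sum_(i \in X) u i <= sup S.
  by apply: ub_le_sup; [case: hS|exists X].
have h2 : \sum_(i \in A) u i <= \sum_(i \in X) u i.
  rewrite [leRHS](fsbigID A)//= setIidr// lerDl.
  by apply: fsumr_ge0 => i [/XD /u0].
apply/andP; split; lra.
Qed.

(** Real and imaginary parts are summed separately. For each, adding [u] makes the terms nonnegative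
    with partial sums at most [2 M]; the sum of [u] is subtracted afterwards. *)
Lemma HasSum_dominated I (D : set I) (f : I -> R[i]) (u : I -> R) (M : R) :
  (forall x, D x -> `|f x| <= (u x)%:C) ->
  (forall A : set I, finite_set A -> A `<=` D -> \sum_(i \in A) u i <= M) ->
  exists s, HasSum D f s.
Proof.
move=> fu hM.
have key (g : R[i] -> R) : (forall z, `|(g z)%:C| <= `|z|) ->
    exists s, HasSum D (fun x => (g (f x))%:C) s.
  move=> hg.
  have gu x : D x -> `|g (f x)| <= u x.
    move=> /fu /(le_trans (hg _)).
    by rewrite normc_def/= expr0n/= addr0 sqrtr_sqr lecR.
  have [s hs] : exists s, HasSum D (fun x => (u x)%:C) s.
    by apply: (@HasSum_ge0 _ _ _ M) => // x Dx; exact: le_trans (gu _ Dx).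
  have [t ht] : exists s, HasSum D (fun x => (g (f x) + u x)%:C) s.
    apply: (@HasSum_ge0 _ _ _ (M + M)) => [x /gu|A fA AD].
      by rewrite ler_norml => /andP[]; lra.
    rewrite fsbig_split//= lerD//; last exact: hM.
    apply: le_trans (hM _ fA AD); rewrite !fsbig_finite//=.
    rewrite big_seq [leRHS]big_seq; apply: ler_sum => i.
    by rewrite in_fset_set// inE => /AD /gu; apply: le_trans (ler_norm _).
  exists (t + (-1) * s); have := HasSumD _ _ _ _ _ _ ht (HasSumZ _ _ _ (-1) _ hs).
  by apply: eq_HasSum => x _; rewrite rmorphD/= mulN1r addrK.
have [z|s hs] := key (@complex.Re R).
  by rewrite !normc_def/= expr0n/= addr0 lecR ler_wsqrtr// lerDl sqr_ge0.
have [z|t ht] := key (@complex.Im R).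
  by rewrite !normc_def/= expr0n/= addr0 lecR ler_wsqrtr// lerDr sqr_ge0.
exists (s + 'i * t); have := HasSumD _ _ _ _ _ _ hs (HasSumZ _ _ _ 'i _ ht).
by apply: eq_HasSum => x _; rewrite -complexE.
Qed.

End UnorderedSums.

(** * The ring of integers *)

Section RingOfIntegers.
Variable F : fieldExtType rat.
Local Notation O := (@Ointeg F).

Lemma OintegP (x : F) : O x <-> integralOver (intr : int -> F) x.
Proof.
by split=> [[p [mp rp]]|[p mp rp]]; [exists p|exists p; split].
Qed.

Lemma Ointeg_int (m : int) : O m%:~R.
Proof. by apply/OintegP; exact: integral_id. Qed.

Lemma Ointeg0 : O 0. Proof. exact: (Ointeg_int 0). Qed.

Lemma Ointeg1 : O 1. Proof. exact: (Ointeg_int 1). Qed.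

Lemma OintegN x : O x -> O (- x).
Proof. by move=> /OintegP hx; apply/OintegP; exact: integral_opp. Qed.

Lemma OintegD x y : O x -> O y -> O (x + y).
Proof. by move=> /OintegP hx /OintegP hy; apply/OintegP; exact: integral_add. Qed.

Lemma OintegB x y : O x -> O y -> O (x - y).
Proof. by move=> hx /OintegN hy; exact: OintegD. Qed.

Lemma OintegM x y : O x -> O y -> O (x * y).
Proof. by move=> /OintegP hx /OintegP hy; apply/OintegP; exact: integral_mul. Qed.

Lemma OintegX x m : O x -> O (x ^+ m).
Proof.
by move=> hx; elim: m => [|m IH]; rewrite ?expr0 ?exprS; [exact: Ointeg1|exact: OintegM].
Qed.

End RingOfIntegers.

(** The question is moved to [algC], where rational algebraic integers are known to be integers. *)
Lemma rat_integral_int (q : rat) :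
  integralOver (intr : int -> rat) q -> exists m : int, q = m%:~R.
Proof.
move=> [p mp rp].
have hint : (ratr q : algC) \in Num.int.
  apply: Cint_rat_Aint; first exact: Crat_rat.
  apply: (@root_monic_Aint (map_poly (intr : int -> algC) p)).
  - have -> : map_poly (intr : int -> algC) p =
        map_poly (ratr : rat -> algC) (map_poly (intr : int -> rat) p).
      by rewrite -map_poly_comp; apply: eq_map_poly => m /=; rewrite rmorph_int.
    by rewrite fmorph_root.
  - exact: monic_map.
  - by apply/polyOverP => i; rewrite coef_map/= intr_int.
case/intrP: hint => m hm; exists m.
by apply: (fmorph_inj (ratr : {rmorphism rat -> algC})); rewrite rmorph_int.
Qed.

(** * Real embeddings, norms and residue systems *)

Section Embeddings.
Variables (R : realType) (F : fieldExtType rat) (n : nat).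
Variable sigma : 'I_n -> {rmorphism F -> R}.
Hypothesis n_gt0 : (0 < n)%N.
Hypothesis dimF : \dim (fullv : {vspace F}) = n.
Hypothesis sigma_inj : forall i j, (forall x, sigma i x = sigma j x) -> i = j.
Local Notation O := (@Ointeg F).

(** Artin's argument: from the relation at [y * x] subtract [sigma i0 y] times the relation at [x].
    The term of [i0] disappears, and the coefficient of [i] acquires the factor
    [sigma i y - sigma i0 y], nonzero for a suitable [y]. *)
Lemma embeddings_independent (r : seq 'I_n) (c : 'I_n -> R) : uniq r ->
  (forall x, \sum_(i <- r) c i * sigma i x = 0) -> forall i, i \in r -> c i = 0.
Proof.
elim: r c => [//|i0 r IH] c /= /andP[i0r ur] h.
have cr i : i \in r -> c i = 0.
  move=> ir.
  have [y hy] : exists y, sigma i y != sigma i0 y.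
    apply: contrapT => hy; move: i0r; rewrite -(@sigma_inj i i0) ?ir// => x.
    by apply/eqP/negPn/negP => ne; apply: hy; exists x.
  have := IH (fun j => c j * (sigma j y - sigma i0 y)) ur _ i ir.
  have h0 x : \sum_(j <- r) c j * (sigma j y - sigma i0 y) * sigma j x = 0.
    have h1 := h (y * x); have h2 := h x.
    rewrite big_cons in h1; rewrite big_cons in h2.
    have -> : \sum_(j <- r) c j * (sigma j y - sigma i0 y) * sigma j x =
       \sum_(j <- r) c j * sigma j (y * x) - sigma i0 y * \sum_(j <- r) c j * sigma j x.
      rewrite mulr_sumr -sumrB; apply: eq_bigr => j _; rewrite rmorphM/=; ring.
    have -> : \sum_(j <- r) c j * sigma j (y * x) = - (c i0 * sigma i0 (y * x)).
      by apply/eqP; rewrite -addr_eq0 addrC h1.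
    have -> : \sum_(j <- r) c j * sigma j x = - (c i0 * sigma i0 x).
      by apply/eqP; rewrite -addr_eq0 addrC h2.
    rewrite rmorphM/=; ring.
  move=> /(_ h0) /eqP; rewrite mulf_eq0 subr_eq0 (negbTE hy) orbF.
  by move/eqP.
move=> i; rewrite inE => /orP[/eqP->|/cr//].
have := h 1; rewrite big_cons rmorph1 mulr1 big_seq big1 ?addr0// => j /cr ->.
by rewrite mul0r.
Qed.

Definition emb_mx (e : n.-tuple F) : 'M[R]_n := \matrix_(i, j) sigma j (tnth e i).

Lemma rmorph_scale_rat (f : {rmorphism F -> R}) (q : rat) x : f (q *: x) = ratr q * f x.
Proof.
rewrite -mulr_algl rmorphM/=; congr (_ * _).
exact: (fmorph_eq_rat (f \o in_alg F)).
Qed.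

Lemma coord_sum (e : n.-tuple F) x (f : {rmorphism F -> R}) : basis_of fullv e ->
  f x = \sum_(i < n) ratr (coord e i x) * f (tnth e i).
Proof.
move=> be; rewrite {1}(coord_basis be (memvf x)) rmorph_sum/=.
by apply: eq_bigr => i _; rewrite rmorph_scale_rat (tnth_nth 0).
Qed.

(** A vector killed by the matrix is a linear relation among the embeddings on a basis, hence on all
    of [F], so independence makes it zero. *)
Lemma emb_mx_unit (e : n.-tuple F) : basis_of fullv e -> emb_mx e \in unitmx.
Proof.
move=> be; rewrite -unitmx_tr -row_free_unit -kermx_eq0; apply/eqP/row_matrixP => k.
set v := row k _; rewrite row0.
have hv : v *m (emb_mx e)^T = 0 by apply/sub_kermxP; exact: row_sub.
apply/rowP => i; rewrite [RHS]mxE.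
suff h x : \sum_(j <- enum 'I_n) v 0 j * sigma j x = 0.
  by apply: (embeddings_independent _ (v 0) (enum_uniq 'I_n) h); rewrite mem_enum.
rewrite big_enum/=.
under eq_bigr => j _ do rewrite (@coord_sum e x (sigma j) be) mulr_sumr.
rewrite exchange_big/= big1// => j _.
have /rowP/(_ j) := hv; rewrite !mxE => /(congr1 (fun t => ratr (coord e j x) * t)).
rewrite mulr0 => {2}<-; rewrite mulr_sumr; apply: eq_bigr => l _.
rewrite !mxE; ring.
Qed.

Lemma basis_fullv : exists e : n.-tuple F, basis_of fullv e.
Proof. by rewrite -dimF; exists (vbasis fullv); exact: vbasisP. Qed.

(** The rational number is the determinant of multiplication by [x] in a basis: [emb_mx] conjugates
    its matrix into the diagonal matrix of the [sigma i x]. *)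
Lemma norm_rat x : exists q : rat, \prod_(i < n) sigma i x = ratr q.
Proof.
have [e be] := basis_fullv; have uA := emb_mx_unit _ be.
pose M : 'M[rat]_n := \matrix_(i, j) coord e j (x * tnth e i).
exists (\det M).
have h : map_mx ratr M *m emb_mx e = emb_mx e *m diag_mx (\row_j sigma j x).
  apply/matrixP => i j; rewrite mul_mx_diag !mxE mulrC -rmorphM/=.
  rewrite (@coord_sum e _ (sigma j) be); apply: eq_bigr => l _.
  by rewrite !mxE.
have := congr1 determinant h; rewrite !det_mulmx mulrC det_diag.
move/mulrI; rewrite -det_map_mx => /(_ _) ->.
  by apply: eq_bigr => i _; rewrite mxE.
by rewrite -unitmxE.
Qed.

Lemma integral_sigma i x : O x -> integralOver (intr : int -> R) (sigma i x).
Proof.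
move=> /OintegP /(@integral_rmorph _ _ _ _ (sigma i)) [p mp rp]; exists p => //.
by rewrite -(@eq_map_poly _ _ (sigma i \o intr))// => m /=; rewrite rmorph_int.
Qed.

Lemma integral_prod (r : seq 'I_n) (P : pred 'I_n) x :
  O x -> integralOver (intr : int -> R) (\prod_(i <- r | P i) sigma i x).
Proof.
move=> Ox; apply: (big_ind (integralOver (intr : int -> R))).
- exact: integral1.
- exact: integral_mul.
- by move=> i _; exact: integral_sigma.
Qed.

Lemma norm_int x : O x -> exists m : int, \prod_(i < n) sigma i x = m%:~R.
Proof.
move=> Ox; have [q hq] := norm_rat x.
have [p mp rp] := integral_prod (index_enum 'I_n) xpredT _ Ox.
have [|m hm] := @rat_integral_int q; last by exists m; rewrite hq hm rmorph_int.
exists p => //; move: rp; rewrite hq.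
have -> : map_poly (intr : int -> R) p =
    map_poly (ratr : rat -> R) (map_poly (intr : int -> rat) p).
  by rewrite -map_poly_comp; apply: eq_map_poly => m /=; rewrite rmorph_int.
by rewrite fmorph_root.
Qed.

(** The norm is an integer of absolute value below 1, hence 0, and a field embedding kills only
    0. *)
Lemma Ointeg_discrete x : O x -> (forall i, `|sigma i x| < 1) -> x = 0.
Proof.
move=> Ox hx; have [m hm] := norm_int x Ox.
have : `|\prod_(i < n) sigma i x| < 1.
  rewrite normr_prod; have {2}<- : \prod_(i < n) (1 : R) = 1 by rewrite big1.
  apply: ltr_prod => [|i _]; last by rewrite normr_ge0 hx.
  by apply/hasP; exists (Ordinal n_gt0); rewrite ?mem_index_enum.
rewrite hm -intr_norm -[ltRHS](@mulr1z R) ltr_int => m1.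
have m0 : m = 0 by lia.
move/eqP: hm; rewrite m0 => /prodf_eq0 [i _].
by rewrite fmorph_eq0 => /eqP.
Qed.

(** Equal integer parts force every conjugate of [x - y] to have absolute value below 1. The shift
    [u] makes room for the real parts of [c_i z_i] in [HasSum_poincare]. *)
Lemma Ointeg_floor_inj (u : 'I_n -> R) x y : O x -> O y ->
  (forall i, Num.floor (sigma i x + u i) = Num.floor (sigma i y + u i)) -> x = y.
Proof.
move=> Ox Oy h; apply/eqP; rewrite -subr_eq0; apply/eqP/Ointeg_discrete; first exact: OintegB.
move=> i; rewrite rmorphB/=.
have := Num.Theory.floor_itv (sigma i x + u i).
have := Num.Theory.floor_itv (sigma i y + u i).
rewrite h intrD => /andP[h1 h2] /andP[h3 h4].
rewrite ltr_norml; apply/andP; split; lra.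
Qed.

(** Integer parts of the conjugates embed the set into a finite box; [M] exceeds [K + 1] to leave
    room for rounding down. *)
Lemma finite_bounded_Ointeg (K : R) :
  finite_set [set x | O x /\ forall i, `|sigma i x| <= K].
Proof.
pose M := Num.bound (K + 1).
have hM : K + 1 < M%:~R.
  have [K0|K0] := leP 0 (K + 1).
    exact: archi_boundP.
  by apply: lt_le_trans K0 _; rewrite ler0z.
pose fl x := [ffun i => Num.floor (sigma i x)].
apply: (@finite_set_inj _ _ fl).
  move=> x y /set_mem[Ox _] /set_mem[Oy _] /ffunP h.
  apply: (Ointeg_floor_inj (fun=> 0) _ _ Ox Oy) => i.
  by have := h i; rewrite !ffunE !addr0.
pose g (h : {ffun 'I_n -> 'I_(M + M).+1}) := [ffun i => (h i)%:Z - M%:Z].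
apply: (@sub_finite_set _ _ (g @` setT)); last exact/finite_image/finite_finset.
move=> _ [x [_ hx] <-].
have hf i : - M%:Z <= Num.floor (sigma i x) <= M%:Z.
  have := Num.Theory.floor_itv (sigma i x); rewrite intrD => /andP[h1 h2].
  have := hx i; rewrite ler_norml => /andP[h3 h4].
  rewrite -!(ler_int R) rmorphN/=; apply/andP; split; lra.
exists [ffun i => inord `|Num.floor (sigma i x) + M%:Z|] => //.
apply/ffunP => i; rewrite !ffunE inordK; have := hf i; lia.
Qed.

(** The cofactor [m / x] lies in [F], and its image under [sigma i0] is the product of the other
    conjugates of [x], which is integral. *)
Lemma norm_cofactor x : O x -> x != 0 ->
  exists2 y, O y & exists2 m : int, x * y = m%:~R & \prod_(i < n) sigma i x = m%:~R.
Proof.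
move=> Ox x0; have [m hm] := norm_int x Ox.
exists (x^-1 * m%:~R); last by exists m; rewrite // mulVKf.
apply/OintegP; pose i0 := Ordinal n_gt0.
have := integral_prod (index_enum 'I_n) (predC1 i0) _ Ox.
have -> : \prod_(i < n | predC1 i0 i) sigma i x = sigma i0 (x^-1 * m%:~R).
  rewrite rmorphM rmorph_int -hm [in RHS](bigD1 i0)//= fmorphV mulKf//.
  by rewrite fmorph_eq0.
move=> [p mp rp]; exists p => //; move: rp.
have -> : map_poly (intr : int -> R) p = map_poly (sigma i0) (map_poly (intr : int -> F) p).
  by rewrite -map_poly_comp; apply: eq_map_poly => j /=; rewrite rmorph_int.
by rewrite fmorph_root.
Qed.

Lemma common_denominator (I : finType) (q : I -> rat) :
  exists2 m : int, m != 0 & forall i, exists z : int, m%:~R * q i = z%:~R.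
Proof.
exists (\prod_i denq (q i)); first by apply/prodf_neq0 => i _; exact: denq_neq0.
move=> i; exists ((\prod_(j | j != i) denq (q j)) * numq (q i)).
by rewrite (bigD1 i)//= !intrM numqE; ring.
Qed.

(** Multiplication by [x] has a rational matrix in a basis. Clearing denominators by [m] gives an
    integer matrix with eigenvalue [m x], the eigenvector being the basis itself, so [m x] is a root
    of its characteristic polynomial. *)
Lemma integral_multiple x : exists2 m : int, m != 0 & O (m%:~R * x).
Proof.
have [e be] := basis_fullv.
pose M i j := coord e j (x * tnth e i).
have [m m0 hm] := @common_denominator ('I_n * 'I_n)%type (fun ij => M ij.1 ij.2).
have [N hN] := choice hm; exists m => //.
pose A : 'M[int]_n := \matrix_(i, j) N (j, i).
exists (char_poly A); split; first exact: char_poly_monic.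
rewrite -/(map_poly intr _) map_char_poly -eigenvalue_root_char.
apply/eigenvalueP; exists (\row_i tnth e i).
  apply/rowP => j; rewrite !mxE -mulrA.
  have -> : x * tnth e j = \sum_(i < n) M j i *: tnth e i.
    rewrite {1}(coord_basis be (memvf (x * tnth e j))).
    by apply: eq_bigr => i _; rewrite -(tnth_nth 0 e i).
  rewrite mulr_sumr; apply: eq_bigr => i _; rewrite !mxE.
  change (tnth e i * (N (j, i))%:~R = m%:~R * (M j i *: tnth e i)).
  by rewrite [LHS]mulrC [LHS]mulrzl [RHS]mulrzl -!scaler_int scalerA (hN (j, i)).
apply/negP => /eqP/rowP h.
have := basis_not0 be (mem_tnth (Ordinal n_gt0) e).
by have := h (Ordinal n_gt0); rewrite !mxE => ->; rewrite eqxx.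
Qed.

Lemma integral_basis : exists e : 'I_n -> F,
  (forall i, O (e i)) /\ forall x, exists q : 'I_n -> rat, x = \sum_(i < n) q i *: e i.
Proof.
have [e be] := basis_fullv.
have /choice[m hm] i : exists m : int, m != 0 /\ O (m%:~R * tnth e i).
  by have [m m0 Om] := integral_multiple (tnth e i); exists m.
exists (fun i => (m i)%:~R * tnth e i); split=> [i|x]; first by case: (hm i).
exists (fun i => coord e i x / (m i)%:~R).
rewrite {1}(coord_basis be (memvf x)); apply: eq_bigr => i _.
rewrite mulrzl -scaler_int scalerA mulfVK ?(tnth_nth 0)//.
by rewrite intr_eq0; case: (hm i).
Qed.

(** Since [p] divides its norm [m], coordinates with respect to integral generators may be reduced
    modulo [m]. Each class modulo [p] therefore meets the finite set of integers with conjugates at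
    most [K]. *)
Lemma residue_system p : O p -> p != 0 -> exists bs : seq F,
  [/\ uniq bs, forall b, b \in bs -> O b,
      forall x, O x -> exists b, b \in bs /\ exists2 y, O y & x = b + p * y
    & forall b b' y, b \in bs -> b' \in bs -> O y -> b' = b + p * y -> b' = b].
Proof.
move=> Op p0; have [y0 Oy0 [m hm hN]] := norm_cofactor p Op p0.
have m0 : m != 0.
  apply: contra_neq p0 => m0; move/eqP: hN; rewrite m0 => /prodf_eq0[i _].
  by rewrite fmorph_eq0 => /eqP.
have [e [Oe he]] := integral_basis.
pose K : R := \sum_(j < n) \sum_(i < n) `|m%:~R| * `|sigma i (e j)|.
pose B0 := [set x | O x /\ forall i, `|sigma i x| <= K].
have fB0 : finite_set B0 by exact: finite_bounded_Ointeg.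
pose cls x := [set b | B0 b /\ exists2 y, O y & x = b + p * y].
have clsP x : O x -> cls x (xget 0 (cls x)).
  move=> Ox; apply: xgetPex; have [q hq] := he x.
  pose fl j := Num.floor (q j / m%:~R).
  pose u := \sum_(j < n) (fl j)%:~R * e j.
  have Ou : O u.
    apply: (big_ind O); [exact: Ointeg0|exact: OintegD|move=> j _].
    by apply: OintegM => //; exact: Ointeg_int.
  exists (x - m%:~R * u); split; last first.
    by exists (y0 * u); [exact: OintegM|rewrite mulrA hm; ring].
  split=> [|i].
    by apply: OintegB => //; apply: OintegM => //; exact: Ointeg_int.
  have -> : x - m%:~R * u = \sum_(j < n) (q j - m%:~R * (fl j)%:~R) *: e j.
    rewrite {1}hq /u mulr_sumr -sumrB; apply: eq_bigr => j _.
    by rewrite scalerBl; congr (_ - _); rewrite -scalerA !scaler_int !mulrzl.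
  rewrite rmorph_sum/=; apply: (le_trans (ler_norm_sum _ _ _)).
  apply: ler_sum => j _; rewrite rmorph_scale_rat normrM.
  rewrite [leRHS](bigD1 i)//=; apply: ler_wpDr.
    by apply: sumr_ge0 => l _; rewrite mulr_ge0.
  apply: ler_wpM2r => //.
  have -> : q j - m%:~R * (fl j)%:~R = m%:~R * (q j / m%:~R - (fl j)%:~R).
    by rewrite mulrBr mulrCA divff ?mulr1// intr_eq0.
  rewrite rmorphM normrM/= ratr_int ler_piMr//.
  have := Num.Theory.floor_itv (q j / m%:~R); rewrite -/(fl j) intrD => /andP[h1 h2].
  rewrite ger0_norm ?ler0q ?subr_ge0// -[leRHS](rmorph1 (ratr : rat -> R)) ler_rat.
  by rewrite lerBlDr addrC ltW.
pose rep x := xget 0 (cls x).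
have fB : finite_set (rep @` O).
  by apply: sub_finite_set fB0 => _ [x Ox <-]; case: (clsP _ Ox).
have /finite_seqP[s hs] := fB.
have hb b : b \in undup s <-> (rep @` O) b by rewrite mem_undup hs.
exists (undup s); split; first exact: undup_uniq.
- by move=> b /hb[x Ox <-]; have [[]] := clsP x Ox.
- by move=> x Ox; exists (rep x); split; [apply/hb; exists x|case: (clsP x Ox)].
- move=> b b' y /hb[x Ox xb] /hb[x' Ox' xb'] Oy bb'.
  have [_ [y1 Oy1 h1]] := clsP x Ox; have [_ [y2 Oy2 h2]] := clsP x' Ox'.
  rewrite -/(rep x) xb in h1; rewrite -/(rep x') xb' in h2.
  (* Congruent elements have the same set [cls], so the choice function returns the same
     representative. *)
  rewrite -xb -xb' /rep; congr xget; apply/seteqP.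
  split=> c [B0c [z Oz hz]]; split => //.
    exists (z - y2 - y + y1); last first.
      have -> : c = b + p * y + p * y2 - p * z by rewrite -bb' -h2 hz; ring.
      by rewrite h1; ring.
    by apply: OintegD => //; do 2 apply: OintegB => //.
  exists (z + y2 + y - y1); last first.
    have -> : c = b + p * y1 - p * z by rewrite -h1 hz; ring.
    by rewrite h2 bb'; ring.
  by apply: OintegB => //; do 2 apply: OintegD => //.
Qed.

Lemma norm_unit x : O x -> \prod_(i < n) sigma i x = 1 -> O x^-1.
Proof.
move=> Ox hx; have x0 : x != 0.
  apply: contra_eq_neq hx => ->; rewrite (bigD1 (Ordinal n_gt0))//= rmorph0 mul0r.
  by rewrite eq_sym oner_neq0.
have [y Oy [m hm hN]] := norm_cofactor x Ox x0.
suff -> : x^-1 = y by [].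
apply: (mulfI x0); rewrite mulfV// hm; apply: (fmorph_inj (sigma (Ordinal n_gt0))).
by rewrite rmorph1 rmorph_int -hN hx.
Qed.

End Embeddings.

(** * Real estimates for the convergence of the series *)

Section RealBounds.
Variable R : realType.

(** Telescoping: [2 / M.+1 - 2 / M.+2] dominates the new term [1 / (1 + M.+1 ^ 2)], and the bound is
    an equality at [M = 0]. *)
Lemma sum_inv_sqr (M : nat) : \sum_(a < M.+1) (1 + a%:R ^+ 2)^-1 <= 3 - 2 / M.+1%:R :> R.
Proof.
elim: M => [|M IH]; first by rewrite big_ord1 expr0n/= addr0 !invr1; lra.
rewrite big_ord_recr/=; apply: (le_trans (lerD IH (lexx _))).
rewrite -subr_ge0.
have -> : (3 - 2 / M.+2%:R - (3 - 2 / M.+1%:R + (1 + M.+1%:R ^+ 2)^-1) : R) =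
   (2 + M.+1%:R ^+ 2 - M.+1%:R) / (M.+2%:R * M.+1%:R * (1 + M.+1%:R ^+ 2)).
  rewrite -[M.+2]addn1 natrD.
  have h : (0 : R) < M.+1%:R by rewrite ltr0n.
  have h2 : (0 : R) < 1 + M.+1%:R ^+ 2 by nra.
  by field; rewrite ?gt_eqF//; lra.
apply: divr_ge0; last by rewrite !mulr_ge0// addr_ge0// sqr_ge0.
nra.
Qed.

(** The [fl a] are distinct points of an integer lattice, and the sum over a box factors into
    one-dimensional sums, each at most [2 * 3 = 6] by [sum_inv_sqr]. *)
Lemma sum_prod_inv_sqr (I : choiceType) (J : finType) (A : set I)
    (fl : I -> J -> int) : finite_set A ->
  (forall a b, A a -> A b -> (forall j, fl a j = fl b j) -> a = b) ->
  \sum_(a \in A) \prod_j (1 + (fl a j)%:~R ^+ 2 : R)^-1 <= 6 ^+ #|J|.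
Proof.
move=> fA inj; have [s us0 hs] : exists2 s : seq I, uniq s & A = [set` s].
  have /finite_seqP[s0 ->] := fA; exists (undup s0); rewrite ?undup_uniq//.
  by apply/seteqP; split=> x /=; rewrite mem_undup.
rewrite hs -fsbig_seq//.
pose M := \max_(a <- s) \max_j `|fl a j|%N.
(* An integer is coded by its absolute value and its sign. Zero has two codes, which only enlarges
   the upper bound. *)
pose h a := [ffun j => (inord `|fl a j|%N : 'I_M.+1, fl a j < 0)].
pose G (b : {ffun J -> 'I_M.+1 * bool}) : R := \prod_j (1 + (b j).1%:R ^+ 2)^-1.
have hM a j : a \in s -> (`|fl a j| < M.+1)%N.
  move=> as_; rewrite ltnS /M.
  apply: (@leq_trans (\max_j `|fl a j|%N)); first exact: leq_bigmax.
  exact: (@leq_bigmax_seq _ _ xpredT (fun a => \max_j `|fl a j|%N)).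
have sA a : a \in s -> A a by rewrite hs.
have hG : \sum_(a <- s) \prod_j (1 + (fl a j)%:~R ^+ 2 : R)^-1 = \sum_(b <- map h s) G b.
  rewrite big_map big_seq [RHS]big_seq; apply: eq_bigr => a as_.
  apply: eq_bigr => j _; rewrite ffunE/= inordK ?hM//.
  by rewrite natr_absz -rmorphXn/= -[in RHS]rmorphXn/= -normrX ger0_norm// sqr_ge0.
have us : uniq (map h s).
  rewrite map_inj_in_uniq// => a b as_ bs /ffunP hab.
  apply: inj; [exact: sA|exact: sA|move=> j].
  have := hab j; rewrite !ffunE => -[/(congr1 val)].
  rewrite /= !inordK ?hM//; lia.
rewrite hG big_uniq//=.
apply: (@le_trans _ _ (\sum_b G b)).
  rewrite [leRHS](bigID (mem (map h s)))/= lerDl sumr_ge0// => b _.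
  by rewrite prodr_ge0// => j _; rewrite invr_ge0 addr_ge0// sqr_ge0.
rewrite -(bigA_distr_bigA (fun _ (b : 'I_M.+1 * bool) => (1 + b.1%:R ^+ 2)^-1 : R))/=.
rewrite prodr_const lerXn2r ?nnegrE//.
  by rewrite sumr_ge0// => b _; rewrite invr_ge0 addr_ge0// sqr_ge0.
rewrite -(pair_bigA _ (fun (a : 'I_M.+1) (_ : bool) => (1 + a%:R ^+ 2)^-1 : R))/=.
under eq_bigr do rewrite big_bool/=.
rewrite big_split/=.
have := sum_inv_sqr M.
have : (0 : R) <= 2 / M.+1%:R by rewrite divr_ge0.
by move: (2 / _) (\sum_(i < _) _) => t S; lra.
Qed.

(** The integer part [m] is within 1 of [u], so [1 + m^2 <= 1 + 2 u^2 + 2 <= 3 (1 + u^2)]. *)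
Lemma inv_sqr_floor (u : R) : (1 + u ^+ 2)^-1 <= 3 * (1 + (Num.floor u)%:~R ^+ 2)^-1.
Proof.
have := Num.Theory.floor_itv u; rewrite intrD; set m := (Num.floor u)%:~R => /andP[h1 h2].
rewrite -ler_pdivrMl// [3^-1 * _]mulrC -invfM lef_pV2 ?posrE; [|nra|nra].
have h3 : (u - m) * (1 - (u - m)) >= 0 by apply: mulr_ge0; lra.
have h4 : 0 <= (2 * u - m) ^+ 2 by exact: sqr_ge0.
nra.
Qed.

(** Here [q] is [|c z + d|^2] for [z = x0 + i y]. The exponential controls small [q] and leaves
    [(1 + q)^-2]; then [(1 + q)^2 >= (1 + (c x0 + d)^2) (1 + (c y)^2)] separates the two lattice
    directions. *)
Lemma gauss_factor_bound (A x0 y : R) (r : nat) : 0 < A -> 0 < y -> (1 < r)%N ->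
  exists2 K : R, 0 <= K & forall c d, 0 < (c * x0 + d) ^+ 2 + (c * y) ^+ 2 ->
    let q := (c * x0 + d) ^+ 2 + (c * y) ^+ 2 in
    (q ^+ r)^-1 * expR (- (A / q)) <=
      K * ((1 + (Num.floor c)%:~R ^+ 2)^-1 * (1 + (Num.floor (c * x0 + d))%:~R ^+ 2)^-1).
Proof.
move=> A0 y0 r1; have r0 : (0 : R) < r%:R by rewrite ltr0n; lia.
(* With [t = 1 / q], this [L] gives [1 + t <= L (1 + A t / r) <= L exp (A t / r)], to be raised to
   the power [r]. *)
pose L := 1 + r%:R / A.
have L0 : 0 < L by rewrite addr_gt0// divr_gt0.
have L1 : 0 < L ^+ r by rewrite exprn_gt0.
have Y0 : 0 < 1 + y ^- 2 by rewrite addr_gt0// invr_gt0 exprn_gt0.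
have step1 (q : R) : 0 < q -> (q ^+ r)^-1 * expR (- (A / q)) <= L ^+ r * ((1 + q) ^- 2).
  move=> q0; pose t := q^-1.
  have t0 : 0 < t by rewrite invr_gt0.
  have h1 : (1 + t) ^+ r <= L ^+ r * expR (A / q).
    have -> : A / q = r%:R * (A * t / r%:R).
      by rewrite [RHS]mulrC divfK ?gt_eqF.
    have [t0' L0'] := (ltW t0, ltW L0).
    rewrite expRM_natl -exprMn lerXn2r ?nnegrE ?addr_ge0 ?mulr_ge0 ?expR_ge0//.
    apply: (@le_trans _ _ (L * (1 + A * t / r%:R))); last first.
      by rewrite ler_wpM2l// expR_ge1Dx.
    have -> : L * (1 + A * t / r%:R) = 1 + t + (r%:R / A + A * t / r%:R).
      by rewrite /L; field; rewrite !gt_eqF.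
    by rewrite lerDl addr_ge0// ltW// ?divr_gt0// mulr_gt0.
  (* Two of the [r] factors [t] are rewritten by [t = (1 + t) / (1 + q)]; this is where [r >= 2]
     enters. *)
  have -> : (q ^+ r)^-1 = (t ^+ (r - 2) * (1 + t) ^+ 2) * (1 + q) ^- 2.
    have -> : 1 + t = t * (1 + q) by rewrite /t mulrDr mulr1 mulVf ?gt_eqF// addrC.
    rewrite exprMn mulrA -exprD subnK//.
    rewrite -mulrA mulfV ?mulr1 ?exprVn//.
    by rewrite expf_eq0/= gt_eqF// addr_gt0.
  rewrite expRN mulrAC ler_wpM2r ?invr_ge0 ?sqr_ge0//.
  rewrite ler_pdivrMr ?expR_gt0//; apply: le_trans h1.
  have -> : (1 + t) ^+ r = (1 + t) ^+ (r - 2) * (1 + t) ^+ 2.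
    by rewrite -exprD subnK.
  by rewrite ler_wpM2r ?sqr_ge0// lerXn2r ?nnegrE; lra.
(* The 9 comes from passing to integer parts twice, the factor [1 + y^-2] from replacing [c y] by
   [c]. *)
exists (L ^+ r * ((1 + y ^- 2) * 9)).
  by rewrite !mulr_ge0// ltW.
move=> c d /=; set u := c * x0 + d => q0.
apply: (le_trans (step1 _ q0)); rewrite -[leRHS]mulrA ler_wpM2l ?(ltW L1)//.
apply: (@le_trans _ _ ((1 + u ^+ 2)^-1 * (1 + (c * y) ^+ 2)^-1)).
  have pu : 0 < 1 + u ^+ 2 by rewrite ltr_wpDr ?sqr_ge0.
  have pc : 0 < 1 + (c * y) ^+ 2 by rewrite ltr_wpDr ?sqr_ge0.
  have pq : 0 < (1 + (u ^+ 2 + (c * y) ^+ 2)) ^+ 2 by rewrite exprn_gt0// addr_gt0.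
  rewrite -invfM lef_pV2 ?posrE ?(mulr_gt0 pu pc)//.
  have := sqr_ge0 u; have := sqr_ge0 (c * y); set a := u ^+ 2; set b := _ ^+ 2 => b0 a0.
  nra.
have h2 : (1 + (c * y) ^+ 2)^-1 <= (1 + y ^- 2) * (1 + c ^+ 2)^-1.
  rewrite -ler_pdivrMl// -invfM lef_pV2 ?posrE ?mulr_gt0//; try by nra.
  have -> : (1 + y ^- 2) * (1 + (c * y) ^+ 2) = 1 + c ^+ 2 * y ^+ 2 + y ^- 2 + c ^+ 2.
    by field; rewrite gt_eqF.
  have : 0 <= c ^+ 2 * y ^+ 2 by rewrite -exprMn sqr_ge0.
  have : 0 <= y ^- 2 by rewrite invr_ge0 sqr_ge0.
  lra.
have h3 := inv_sqr_floor u; have h4 := inv_sqr_floor c.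
have pos (v : R) : 0 <= (1 + v ^+ 2)^-1 by rewrite invr_ge0 addr_ge0// sqr_ge0.
have h5 : (1 + (c * y) ^+ 2)^-1 <= (1 + y ^- 2) * (3 * (1 + (Num.floor c)%:~R ^+ 2)^-1).
  by apply: (le_trans h2); rewrite ler_wpM2l// (ltW Y0).
apply: (le_trans (ler_pM (pos _) (pos _) h3 h5)).
set p1 := (1 + _)^-1; set p2 := (1 + _)^-1; set p3 := 1 + _.
suff -> : 3 * p1 * (p3 * (3 * p2)) = p3 * 9 * (p2 * p1) by [].
ring.
Qed.

End RealBounds.

(** * Two by two matrices and cosets of translations *)

Section Matrices.
Variable F : fieldExtType rat.
Local Notation O := (@Ointeg F).
Implicit Types (a b c d : F) (g h : 'M[F]_2).

Definition mx2 a b c d : 'M[F]_2 :=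
  \matrix_(i < 2, j < 2)
    if i == 0 then if j == 0 then a else b else if j == 0 then c else d.

Lemma mx2E a b c d : (mx2 a b c d 0 0 = a) * (mx2 a b c d 0 1 = b) *
  (mx2 a b c d 1 0 = c) * (mx2 a b c d 1 1 = d).
Proof. by do !split; rewrite mxE. Qed.

Lemma mx2_eta g : g = mx2 (g 0 0) (g 0 1) (g 1 0) (g 1 1).
Proof.
apply/matrixP => i j; rewrite mxE.
by case: i => [[|[|//]] hi]; case: j => [[|[|//]] hj]; rewrite -?val_eqE/=;
  congr (g _ _); apply/val_inj.
Qed.

Lemma mx2_inj a b c d a' b' c' d' :
  mx2 a b c d = mx2 a' b' c' d' -> [/\ a = a', b = b', c = c' & d = d'].
Proof.
move=> /matrixP h; have := (h 0 0, h 0 1, h 1 0, h 1 1).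
by rewrite !mx2E => -[[[]]].
Qed.

Lemma mulmx2 a b c d a' b' c' d' : mx2 a b c d *m mx2 a' b' c' d' =
  mx2 (a * a' + b * c') (a * b' + b * d') (c * a' + d * c') (c * b' + d * d').
Proof.
apply/matrixP => i j; rewrite !mxE big_ord_recl big_ord1 !mxE.
by case: i => [[|[|//]] hi]; case: j => [[|[|//]] hj]; rewrite -?val_eqE/=.
Qed.

Lemma det_mx2 a b c d : \det (mx2 a b c d) = a * d - b * c.
Proof.
rewrite (expand_det_row _ 0) big_ord_recl big_ord1 /cofactor !det_mx11 !mxE/=.
by rewrite expr0 expr1 mulN1r mulrN mul1r.
Qed.

Lemma det2 g : \det g = g 0 0 * g 1 1 - g 0 1 * g 1 0.
Proof. by rewrite {1}[g]mx2_eta det_mx2. Qed.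

Lemma Gamma0_mx2 (N : set F) a b c d : Gamma0 N (mx2 a b c d) <->
  [/\ [/\ O a, O b, O c & O d], a * d - b * c = 1 & N c].
Proof.
rewrite /Gamma0/= det_mx2 mx2E; split=> [[h -> Nc]|[[ha hb hc hd] -> Nc]]; split=> //.
  by have := (h 0 0, h 0 1, h 1 0, h 1 1); rewrite !mx2E => -[[[]]].
by move=> i j; rewrite mxE; case: ifP; case: ifP.
Qed.

Lemma Gamma0P (N : set F) g : Gamma0 N g <->
  [/\ [/\ O (g 0 0), O (g 0 1), O (g 1 0) & O (g 1 1)],
      g 0 0 * g 1 1 - g 0 1 * g 1 0 = 1 & N (g 1 0)].
Proof. by rewrite {1}[g]mx2_eta; exact: Gamma0_mx2. Qed.

Lemma NGammaP h : NGamma h <-> exists2 b, O b & h = mx2 1 b 0 1.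
Proof.
suff e b : \matrix_(i < 2, j < 2)
    (if i == j then 1 else if (i == 0) && (j == 1) then b else 0) = mx2 1 b 0 1.
  by split=> -[b Ob ->]; exists b => //; rewrite e.
apply/matrixP => i j; rewrite !mxE.
by case: i => [[|[|//]] hi]; case: j => [[|[|//]] hj]; rewrite -?val_eqE/=.
Qed.

Lemma NGamma1 : NGamma (1%:M : 'M[F]_2).
Proof.
apply/NGammaP; exists 0; first exact: Ointeg0.
by rewrite [1%:M]mx2_eta !mxE.
Qed.

Lemma NGammaM h h' : NGamma h -> NGamma h' -> NGamma (h *m h').
Proof.
move=> /NGammaP[b Ob ->] /NGammaP[b' Ob' ->]; apply/NGammaP; exists (b' + b).
  exact: OintegD.
by rewrite mulmx2; congr mx2; ring.
Qed.

Lemma NGammaV h : NGamma h -> exists2 h', NGamma h' & h' *m h = 1%:M.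
Proof.
move=> /NGammaP[b Ob ->]; exists (mx2 1 (- b) 0 1).
  by apply/NGammaP; exists (- b) => //; exact: OintegN.
by rewrite mulmx2 [RHS]mx2_eta !mxE/=; congr mx2; ring.
Qed.

Definition ucoset g : set 'M[F]_2 := [set h *m g | h in @NGamma F].

Lemma ucoset_refl g : ucoset g g.
Proof. by exists 1%:M; [exact: NGamma1|rewrite mul1mx]. Qed.

Lemma ucosetM g h : NGamma h -> ucoset (h *m g) = ucoset g.
Proof.
move=> Nh; have [h' Nh' h'h] := NGammaV _ Nh.
apply/seteqP; split=> _ [u Nu <-].
  by exists (u *m h); [exact: NGammaM|rewrite mulmxA].
exists (u *m h'); first exact: NGammaM.
by rewrite mulmxA -(mulmxA u) h'h mulmx1.
Qed.

(** The same choice of representative as inside [poincare], hence [xget] with default 0. *)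
Definition crep (C : set 'M[F]_2) : 'M[F]_2 := xget 0 C.

Lemma crepP g : exists2 h, NGamma h & crep (ucoset g) = h *m g.
Proof.
have /(@xgetPex _ 0) [h Nh hg] : exists x, ucoset g x by exists g; exact: ucoset_refl.
by exists h.
Qed.

Definition ustable (G : set 'M[F]_2) := forall h g, NGamma h -> G g -> G (h *m g).

Lemma coset_crep (G : set 'M[F]_2) C : ustable G -> cosets G C ->
  G (crep C) /\ C = ucoset (crep C).
Proof.
move=> sG [g Gg ->]; rewrite -/(ucoset g); have [h Nh ->] := crepP g.
by rewrite ucosetM//; split => //; exact: sG.
Qed.

Lemma Gamma0_ustable (N : set F) : ustable (Gamma0 N).
Proof.
move=> h g /NGammaP[b Ob ->]; rewrite [g]mx2_eta mulmx2.
move=> /Gamma0_mx2[[Oa Ob' Oc Od] d1 Nc]; apply/Gamma0_mx2.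
have e : 0 * g 0 0 + 1 * g 1 0 = g 1 0 by ring.
have e' : 0 * g 0 1 + 1 * g 1 1 = g 1 1 by ring.
rewrite e e' !mul1r; split => //; last by rewrite -d1; ring.
by split => //; apply: OintegD => //; exact: OintegM.
Qed.

(** Two matrices of determinant 1 with the same bottom row differ on the left by a translation,
    whose entry is read off from [g] times the inverse of [g']. Cosets are thus determined by bottom
    rows. *)
Lemma Gamma0_same_row (N : set F) g g' : Gamma0 N g -> Gamma0 N g' ->
  g 1 0 = g' 1 0 -> g 1 1 = g' 1 1 -> ucoset g = ucoset g'.
Proof.
move=> /Gamma0P[[Oa Ob Oc Od] d1 _] /Gamma0P[[Oa' Ob' Oc' Od'] d1' _] ec ed.
have -> : g = mx2 1 (g' 0 0 * g 0 1 - g' 0 1 * g 0 0) 0 1 *m g'.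
  rewrite [LHS]mx2_eta [X in _ *m X]mx2_eta mulmx2 -ec -ed; rewrite -ec -ed in d1'.
  congr mx2; [| |ring|ring].
    transitivity (g 0 0 * (g' 0 0 * g 1 1 - g' 0 1 * g 1 0)); first by rewrite d1' mulr1.
    rewrite -[in RHS]d1; ring.
  transitivity (g 0 1 * (g' 0 0 * g 1 1 - g' 0 1 * g 1 0)); first by rewrite d1' mulr1.
  rewrite -[in RHS]d1; ring.
apply: ucosetM; apply/NGammaP; eexists; last by [].
by apply: OintegB; apply: OintegM.
Qed.

End Matrices.

Arguments mx2 {F}.
Arguments ucoset {F}.
Arguments crep {F}.
Arguments ustable {F}.

#[local] Arguments pi : simpl never.

(** * The exponential [exp (2 pi i w)] *)

Section ComplexExponential.
Variable R : realType.
Implicit Types (w : R[i]) (t : R).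

Lemma ImD w w' : complex.Im (w + w') = complex.Im w + complex.Im w'.
Proof. by case: w; case: w'. Qed.

Lemma ImZ t w : complex.Im (t%:C * w) = t * complex.Im w.
Proof. by case: w => a b /=; rewrite mul0r addr0. Qed.

Lemma normc_e1 w : `|e1 w| = (expR (- (2 * pi) * complex.Im w))%:C.
Proof.
rewrite normc_def/= !exprMn -mulrDr cos2Dsin2 mulr1 sqrtr_sqr.
by rewrite ger0_norm// expR_ge0.
Qed.

Lemma e1D w w' : e1 (w + w') = e1 w * e1 w'.
Proof.
case: w => a b; case: w' => a' b'; rewrite /e1/= !mulrDr expRD cosD sinD.
by apply/eqP; rewrite eq_complex /=; apply/andP; split; apply/eqP; ring.
Qed.

Lemma e1_int (m : int) : e1 (m%:~R)%:C = 1 :> R[i].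
Proof.
have hn (j : nat) : e1 (j%:R)%:C = 1 :> R[i].
  rewrite /e1/= mulr0 expR0 !mul1r.
  have -> : 2 * pi * j%:R = 0 + pi *+ 2 *+ j :> R.
    by rewrite add0r -[RHS]mulr_natr -[pi *+ 2]mulr_natl.
  by rewrite (periodicn (@cosD2pi R)) (periodicn (@sinD2pi R)) cos0 sin0.
case: m => j; first exact: hn.
have := e1D (j.+1%:R)%:C (- j.+1%:R)%:C; rewrite -rmorphD/= subrr.
by rewrite hn mul1r NegzE mulrNz => <-; exact: (hn 0).
Qed.

(** Only the fractional part [f] of [t] matters. If it were nonzero, [sin (pi f)] would be positive
    and [cos (2 pi f) = 1 - 2 sin (pi f)^2] would be below 1. *)
Lemma e1_eq1 t : e1 t%:C = 1 -> exists m : int, t = m%:~R.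
Proof.
move=> h; exists (Num.floor t).
have := Num.Theory.floor_itv t; rewrite intrD => /andP[h1 h2].
set f := t - (Num.floor t)%:~R.
have hf : e1 f%:C = 1 :> R[i].
  have := e1D f%:C ((Num.floor t)%:~R)%:C.
  by rewrite -rmorphD/= /f subrK h e1_int mulr1.
apply/eqP; rewrite -subr_eq0 -/f; apply/negP => /negP f0.
have f_gt0 : 0 < f by rewrite lt_neqAle eq_sym f0/= subr_ge0.
have : 0 < sin (pi * f).
  apply: sin_gt0_pi; rewrite mulr_gt0 ?pi_gt0//= -[ltRHS]mulr1 ltr_pM2l ?pi_gt0//.
  by rewrite /f; lra.
move: hf => /(congr1 (@complex.Re R)) /=.
rewrite mulr0 expR0 mul1r -[2 * pi * f]mulrA mulr_natl mulr2n cosD.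
have := cos2Dsin2 (pi * f); nra.
Qed.

End ComplexExponential.

(** * Terms of the series and their absolute values *)

Section Terms.
Variables (R : realType) (F : fieldExtType rat) (n : nat).
Variable sigma : 'I_n -> {rmorphism F -> R}.
Local Notation O := (@Ointeg F).
Implicit Types (g h : 'M[F]_2) (z : 'I_n -> R[i]).

Definition jfac g z i := (sigma i (g 1 0))%:C * z i + (sigma i (g 1 1))%:C.

Definition pterm (k : nat) (mu : F) z g := (Ncz_d sigma g z k)^-1 * e_mu sigma mu (act sigma g z).

Lemma poincareE k N mu z : poincare sigma k N mu z =
  fam_sum (cosets (Gamma0 N)) (fun C => pterm k mu z (crep C)).
Proof. by []. Qed.

(** The square of [|c_i z_i + d_i|], expanded in the form of [gauss_factor_bound]. *)
Definition jsq g z i : R :=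
  (sigma i (g 1 0) * complex.Re (z i) + sigma i (g 1 1)) ^+ 2
  + (sigma i (g 1 0) * complex.Im (z i)) ^+ 2.

Lemma jsqE g z i : (jsq g z i)%:C = `|jfac g z i| ^+ 2.
Proof.
rewrite -add_Re2_Im2; congr (_ %:C); rewrite /jsq /jfac.
by case: (z i) => a b /=; congr (_ ^+ 2 + _ ^+ 2); ring.
Qed.

Lemma jsq_gt0 g z i : Hn z -> \det g != 0 -> 0 < jsq g z i.
Proof.
move=> hz; rewrite det2 => dg.
rewrite /jsq; have [c0|c0] := eqVneq (g 1 0) 0.
  rewrite c0 rmorph0 !mul0r add0r expr0n/= addr0 exprn_even_gt0//= fmorph_eq0.
  by apply: contra_neq dg => ->; rewrite c0; ring.
rewrite ltr_wpDl ?sqr_ge0// exprn_even_gt0//= mulf_neq0 ?fmorph_eq0//.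
by rewrite gt_eqF.
Qed.

Lemma jfac_neq0 g z i : Hn z -> \det g != 0 -> jfac g z i != 0.
Proof.
move=> hz dg; rewrite -normr_eq0 -sqrf_eq0 -jsqE.
by rewrite -(rmorph0 (real_complex R)) (inj_eq (@complexI R)) gt_eqF ?jsq_gt0.
Qed.

Lemma Im_act g z i : Hn z -> \det g != 0 ->
  complex.Im (act sigma g z i) = sigma i (\det g) * complex.Im (z i) / jsq g z i.
Proof.
move=> hz dg; have := jsq_gt0 _ _ i hz dg; rewrite /act /jsq.
rewrite det2 rmorphB !rmorphM/=.
case: (z i) => x y /=; set a := sigma i _; set b := sigma i _; set c := sigma i _; set d := sigma i _.
move=> q0.
rewrite !(mul0r, addr0, subr0, add0r).
by field; rewrite gt_eqF.
Qed.

(** The even weight [2 r] makes the modulus of the automorphy factor a power of [jsq], and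
    [Im (g z) = Im z / |c z + d|^2] in determinant 1 gives the exponential. *)
Lemma norm_pterm g z mu (r : nat) : Hn z -> \det g = 1 ->
  `|pterm r.*2 mu z g| = (\prod_(i < n) ((jsq g z i ^+ r)^-1 *
     expR (- (2 * pi * sigma i mu * complex.Im (z i) / jsq g z i))))%:C.
Proof.
move=> hz dg; have dg0 : \det g != 0 by rewrite dg oner_neq0.
rewrite /pterm normrM normfV /Ncz_d normr_prod big_split/= rmorphM/=; congr (_ * _).
  rewrite prodfV fmorphV; congr (_^-1); rewrite rmorph_prod; apply: eq_bigr => i _.
  by rewrite -muln2 mulnC exprM normrX normrX -jsqE rmorphXn.
rewrite /e_mu normc_e1; congr (_ %:C).
rewrite (big_morph _ (@ImD R) (erefl : complex.Im 0 = 0 :> R)) mulr_sumr expR_sum.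
apply: eq_bigr => i _; rewrite ImZ Im_act// dg rmorph1 mul1r; congr expR; ring.
Qed.

End Terms.

Arguments jfac {R F n}.
Arguments pterm {R F n}.
Arguments jsq {R F n}.

(** * Absolute convergence of the Poincare series *)

Section Convergence.
Variables (R : realType) (F : fieldExtType rat) (n : nat).
Variable sigma : 'I_n -> {rmorphism F -> R}.
Hypothesis n_gt0 : (0 < n)%N.
Hypothesis dimF : \dim (fullv : {vspace F}) = n.
Hypothesis sigma_inj : forall i j, (forall x, sigma i x = sigma j x) -> i = j.
Local Notation O := (@Ointeg F).

(* The bottom rows of [Gamma0 N] form a subset of a lattice, and reading off the integer parts
   of [c_i] and of [Re (c_i z_i + d_i)] is injective on it. *)
Lemma HasSum_poincare (r : nat) (mu : F) (z : 'I_n -> R[i]) (N : set F) :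
  (1 < r)%N -> Hn z -> totpos sigma mu ->
  HasSum (cosets (Gamma0 N)) (fun C => pterm sigma r.*2 mu z (crep C))
    (poincare sigma r.*2 N mu z).
Proof.
move=> r1 hz mu0; rewrite poincareE.
suff [s hs] : exists s, HasSum (cosets (Gamma0 N)) (fun C => pterm sigma r.*2 mu z (crep C)) s.
  by rewrite (fam_sum_eq _ _ _ _ _ hs).
have hK i : exists K : R, 0 <= K /\ forall c d : R,
    0 < (c * complex.Re (z i) + d) ^+ 2 + (c * complex.Im (z i)) ^+ 2 ->
    let q := (c * complex.Re (z i) + d) ^+ 2 + (c * complex.Im (z i)) ^+ 2 in
    (q ^+ r)^-1 * expR (- (2 * pi * sigma i mu * complex.Im (z i) / q)) <=
      K * ((1 + (Num.floor c)%:~R ^+ 2)^-1 *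
           (1 + (Num.floor (c * complex.Re (z i) + d))%:~R ^+ 2)^-1).
  have A0 : 0 < 2 * pi * sigma i mu * complex.Im (z i).
    by rewrite !mulr_gt0 ?pi_gt0//; exact: hz.
  have [K K0 hK] := gauss_factor_bound _ _ (complex.Re (z i)) _ _ A0 (hz i) r1.
  by exists K; split.
have /choice[K {}hK] := hK.
pose fl C (j : 'I_n * bool) : int :=
  if j.2 then Num.floor (sigma j.1 (crep C 1 0))
  else Num.floor (sigma j.1 (crep C 1 0) * complex.Re (z j.1) + sigma j.1 (crep C 1 1)).
have K0 : 0 <= \prod_i K i by rewrite prodr_ge0// => i _; case: (hK i).
apply: (@HasSum_dominated _ _ _ _
  (fun C => \prod_i K i * \prod_j (1 + (fl C j)%:~R ^+ 2)^-1)
  (\prod_i K i * 6 ^+ #|{: 'I_n * bool}|)) => [C CG|A fA AG].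
  have [/[dup] GC [_ dC _] _] := coset_crep _ _ _ (Gamma0_ustable _ N) CG.
  rewrite norm_pterm// lecR.
  rewrite -(pair_bigA _ (fun i b => (1 + (fl C (i, b))%:~R ^+ 2)^-1 : R))/= -big_split/=.
  apply: ler_prod => i _; apply/andP; split.
    by rewrite mulr_ge0 ?expR_ge0// invr_ge0 exprn_ge0// addr_ge0// sqr_ge0.
  rewrite big_bool/=; case: (hK i) => _; apply.
  by apply: jsq_gt0; rewrite // dC oner_neq0.
rewrite -mulr_fsumr ler_wpM2l//; apply: sum_prod_inv_sqr => // C C' /AG CG /AG CG' hfl.
have [/[dup] GC [OC _ _] ->] := coset_crep _ _ _ (Gamma0_ustable _ N) CG.
have [/[dup] GC' [OC' _ _] ->] := coset_crep _ _ _ (Gamma0_ustable _ N) CG'.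
have ec : crep C 1 0 = crep C' 1 0.
  apply: (Ointeg_floor_inj _ _ _ sigma n_gt0 dimF sigma_inj (fun=> 0)) => // i.
  by have := hfl (i, true); rewrite /fl/= !addr0.
apply: (Gamma0_same_row _ N) => //.
apply: (Ointeg_floor_inj _ _ _ sigma n_gt0 dimF sigma_inj
  (fun i => sigma i (crep C 1 0) * complex.Re (z i))) => // i.
have := hfl (i, false); rewrite /fl/= -ec.
by rewrite ![sigma i (crep _ 1 0) * _ + _]addrC.
Qed.

End Convergence.

(** * Summation over translation cosets in two ways *)

Section DoubleCosets.
Variables (R : realType) (F : fieldExtType rat).
Implicit Types (g h b : 'M[F]_2).

(** The right-hand conditions allow for the arbitrary choice of coset representatives. Replacing [g]
    by a translate may change the matching [b], so surjectivity is required for every [g'] in the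
    coset, and injectivity first identifies the cosets and compares [b] with [b'] only when
    [g = g']. *)
Record two_sided_reps (G Delta : set 'M[F]_2) (bs : seq 'M[F]_2) : Prop := {
  reps_uniq : uniq bs;
  reps_ustableG : ustable G;
  reps_ustable : ustable Delta;
  reps_mul g b : G g -> b \in bs -> Delta (g *m b) /\ Delta (b *m g);
  reps_left_inj g g' b b' : G g -> G g' -> b \in bs -> b' \in bs ->
    g *m b = g' *m b' -> g = g' /\ b = b';
  reps_left_surj x : Delta x -> exists g b, [/\ G g, b \in bs & x = g *m b];
  reps_right_inj h b b' g g' : NGamma h -> b \in bs -> b' \in bs -> G g -> G g' ->
    h *m b *m g = b' *m g' -> ucoset g = ucoset g' /\ (g = g' -> b = b');
  reps_right_surj x : Delta x -> exists2 g, G g & forall g', ucoset g g' ->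
    exists h b, [/\ NGamma h, b \in bs & x = h *m b *m g'] }.

(* [Delta] is at once the disjoint union of the [G b] and a union of the [U b G], where [U] is
   the group of integral translations; the two ways of listing [U \ Delta] are compared. *)
Lemma sum_double_cosets (G Delta : set 'M[F]_2) (bs : seq 'M[F]_2) (f : 'M[F]_2 -> R[i])
    (s t : 'M[F]_2 -> R[i]) :
  two_sided_reps G Delta bs ->
  (forall h g, NGamma h -> Delta g -> f (h *m g) = f g) ->
  (forall b, b \in bs -> HasSum (cosets G) (fun C => f (crep C *m b)) (s b)) ->
  (forall b, b \in bs -> HasSum (cosets G) (fun C => f (b *m crep C)) (t b)) ->
  \sum_(b <- bs) s b = \sum_(b <- bs) t b.
Proof.
case=> ubs sG sD hD h2 h3 h5 h4 finv hs ht.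
have crG C : cosets G C -> G (crep C) /\ C = ucoset (crep C) by exact: coset_crep.
have fcrep g : Delta g -> f (crep (ucoset g)) = f g.
  by move=> Dg; have [h Nh ->] := crepP _ g; exact: finv.
have ucoset_inj g g' : ucoset g = ucoset g' -> exists2 h, NGamma h & g' = h *m g.
  move=> e; have : ucoset g' g' by exact: ucoset_refl.
  by rewrite -e => -[h Nh <-]; exists h.
(* Each listing is a bijection from pairs of a coset and a [b] onto the cosets of [Delta], so both
   double sums compute the same sum over [U \ Delta]. *)
have key (phi : set 'M[F]_2 * 'M[F]_2 -> 'M[F]_2) (u : 'M[F]_2 -> R[i]) :
    (forall C b, cosets G C -> b \in bs -> Delta (phi (C, b))) ->
    set_bij [set Cb | cosets G Cb.1 /\ Cb.2 \in bs] (cosets Delta) (fun Cb => ucoset (phi Cb)) ->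
    (forall b, b \in bs -> HasSum (cosets G) (fun C => f (phi (C, b))) (u b)) ->
    HasSum (cosets Delta) (fun C => f (crep C)) (\sum_(b <- bs) u b).
  move=> hphi bij hu; apply/(HasSum_bij _ _ _ _ _ _ _ _ bij).
  have := HasSum_seq _ _ _ _ _ (fun Cb => f (phi Cb)) u ubs hu.
  by apply: eq_HasSum => -[C b] /= [GC hb]; rewrite fcrep//; exact: hphi.
apply: (@HasSum_unique _ _ (cosets Delta) (fun C => f (crep C))).
  apply: (key (fun Cb => crep Cb.1 *m Cb.2)) => //.
    by move=> C b /crG[GC _] hb; have [] := hD _ _ GC hb.
  split.
  - move=> -[C b] /= [/crG[GC _] hb]; exists (crep C *m b) => //.
    by have [] := hD _ _ GC hb.
  - move=> [C b] [C' b'] /set_mem[/= /crG[GC eC] hb] /set_mem[/= /crG[GC' eC'] hb'].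
    move=> /ucoset_inj[h Nh]; rewrite mulmxA => e.
    have [e1 ->] := h2 _ _ _ _ GC' (sG _ _ Nh GC) hb' hb e.
    by rewrite eC' e1 ucosetM// -eC.
  - move=> _ [x Dx ->]; have [g [b [Gg hb ->]]] := h3 x Dx.
    exists (ucoset g, b) => /=; first by split => //; exists g.
    by have [h Nh ->] := crepP _ g; rewrite -mulmxA ucosetM.
apply: (key (fun Cb => Cb.2 *m crep Cb.1)) => //.
  by move=> C b /crG[GC _] hb; have [] := hD _ _ GC hb.
split.
- move=> -[C b] /= [/crG[GC _] hb]; exists (b *m crep C) => //.
  by have [] := hD _ _ GC hb.
- move=> [C b] [C' b'] /set_mem[/= /crG[GC eC] hb] /set_mem[/= /crG[GC' eC'] hb'].
  move=> /ucoset_inj[h Nh]; rewrite mulmxA => e.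
  have [] := h5 _ _ _ _ _ Nh hb hb' GC GC' (esym e).
  by rewrite -eC -eC' => eCC'; rewrite eCC' => ->.
- move=> _ [x Dx ->]; have [g Gg hg] := h4 x Dx.
  have [|h [b [Nh hb ->]]] := hg (crep (ucoset g)).
    by have [h Nh ->] := crepP _ g; exists h.
  exists (ucoset g, b) => /=; first by split => //; exists g.
  by apply/esym; rewrite -(mulmxA h); exact: ucosetM.
Qed.

End DoubleCosets.

(** * Upper triangular matrices and the Hecke relation *)

Section HeckeTerms.
Variables (R : realType) (F : fieldExtType rat) (n : nat).
Variable sigma : 'I_n -> {rmorphism F -> R}.
Local Notation O := (@Ointeg F).
Implicit Types (g h : 'M[F]_2) (z w : 'I_n -> R[i]) (a b d mu : F).

Lemma totpos_neq0 (i : 'I_n) a : totpos sigma a -> a != 0.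
Proof. by move=> /(_ i); apply: contraTneq => ->; rewrite rmorph0 ltxx. Qed.

Lemma totposM a b : totpos sigma a -> totpos sigma b -> totpos sigma (a * b).
Proof. by move=> a0 b0 i; rewrite rmorphM mulr_gt0 ?a0 ?b0. Qed.

Lemma totposV a : totpos sigma a -> totpos sigma a^-1.
Proof. by move=> a0 i; rewrite fmorphV invr_gt0 a0. Qed.

Lemma act_upper_Hn a b d z : totpos sigma a -> totpos sigma d -> Hn z ->
  Hn (act sigma (mx2 a b 0 d) z).
Proof.
move=> a0 d0 hz i; have dg : \det (mx2 a b 0 d) != 0.
  by rewrite det_mx2 mulr0 subr0 mulf_neq0 ?(totpos_neq0 i).
rewrite Im_act// det_mx2 mulr0 subr0 rmorphM.
by rewrite divr_gt0 ?jsq_gt0// mulr_gt0 ?hz// mulr_gt0 ?a0 ?d0.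
Qed.

Lemma sigmaC_neq0 d i : d != 0 -> (sigma i d)%:C != 0 :> R[i].
Proof. by move=> d0; rewrite !fmorph_eq0. Qed.

Lemma sum_RtoC (f : 'I_n -> R) : \sum_(i < n) (f i)%:C = (\sum_(i < n) f i)%:C.
Proof. by rewrite rmorph_sum. Qed.

Lemma e_mu_affine mu w a b d : d != 0 ->
  e_mu sigma mu (fun i => ((sigma i a)%:C * w i + (sigma i b)%:C) / (sigma i d)%:C) =
  e1 (trace sigma (mu * b / d))%:C * e_mu sigma (mu * a / d) w.
Proof.
move=> d0; rewrite /e_mu -e1D; congr e1.
rewrite /trace -sum_RtoC -big_split/=; apply: eq_bigr => i _.
have dC := sigmaC_neq0 _ i d0.
rewrite !fmorph_div/= !rmorphM/=.
by field.
Qed.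

Lemma actE g z i : act sigma g z i =
  ((sigma i (g 0 0))%:C * z i + (sigma i (g 0 1))%:C) / jfac sigma g z i.
Proof. by []. Qed.

(** The value of [N(cz+d)^-k] for an upper triangular matrix, constant in [z]. *)
Definition uppfac (k : nat) d : R[i] := (\prod_(i < n) (sigma i d)%:C ^+ k)^-1.

(** Left multiplication composes the action of [g] with an affine map, so it rescales the index [mu]
    and contributes a constant character value. *)
Lemma pterm_upper_left k mu z g a b d : Hn z -> \det g != 0 -> d != 0 ->
  pterm sigma k mu z (mx2 a b 0 d *m g) =
  uppfac k d * e1 (trace sigma (mu * b / d))%:C * pterm sigma k (mu * a / d) z g.
Proof.
move=> hz dg d0; rewrite /pterm.
have -> : Ncz_d sigma (mx2 a b 0 d *m g) z k =
    (\prod_(i < n) (sigma i d)%:C ^+ k) * Ncz_d sigma g z k.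
  rewrite /Ncz_d -big_split/=; apply: eq_bigr => i _.
  rewrite -exprMn; congr (_ ^+ _).
  by rewrite [X in _ *m X]mx2_eta mulmx2 !mx2E !mul0r !add0r !rmorphM/=; ring.
have -> : act sigma (mx2 a b 0 d *m g) z =
    (fun i => ((sigma i a)%:C * act sigma g z i + (sigma i b)%:C) / (sigma i d)%:C).
  apply/funext => i; have := jfac_neq0 _ _ _ sigma g z i hz dg; rewrite /jfac /act => j0.
  have dC := sigmaC_neq0 _ i d0.
  rewrite [X in _ *m X]mx2_eta mulmx2 !mx2E !mul0r !add0r !rmorphD !rmorphM/=.
  rewrite -[X in _ / (X + _)]mulrA -[X in _ / X]mulrDr.
  set j := _ * z i + (sigma i (g 1 1))%:C in j0 *.
  rewrite (_ : _ * z i + (_ + _) = (sigma i a)%:C *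
    ((sigma i (g 0 0))%:C * z i + (sigma i (g 0 1))%:C) + (sigma i b)%:C * j); last first.
    by rewrite /j; ring.
  by clearbody j; field; rewrite dC j0.
rewrite e_mu_affine// /uppfac invfM; ring.
Qed.

(** By the cocycle rule for the automorphy factor, right multiplication keeps [mu] and moves the
    point [z]. *)
Lemma pterm_upper_right k mu z g a b d : Hn z -> totpos sigma a -> totpos sigma d -> \det g = 1 ->
  (0 < n)%N -> pterm sigma k mu z (g *m mx2 a b 0 d) =
  uppfac k d * pterm sigma k mu (act sigma (mx2 a b 0 d) z) g.
Proof.
move=> hz a0 d0 dg n0; rewrite /pterm.
have dn0 := totpos_neq0 (Ordinal n0) _ d0.
have hz' := act_upper_Hn a b d z a0 d0 hz.
have dg0 : \det g != 0 by rewrite dg oner_neq0.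
have acE i : act sigma (mx2 a b 0 d) z i =
    ((sigma i a)%:C * z i + (sigma i b)%:C) / (sigma i d)%:C.
  by rewrite /act !mx2E rmorph0 mul0r add0r.
have -> : Ncz_d sigma (g *m mx2 a b 0 d) z k =
    (\prod_(i < n) (sigma i d)%:C ^+ k) * Ncz_d sigma g (act sigma (mx2 a b 0 d) z) k.
  rewrite /Ncz_d -big_split/=; apply: eq_bigr => i _.
  rewrite -exprMn; congr (_ ^+ _); rewrite acE.
  have dC := sigmaC_neq0 _ i dn0.
  rewrite [X in X *m _]mx2_eta mulmx2 !mx2E mulr0 addr0 !rmorphD !rmorphM/=.
  by field.
have -> : act sigma (g *m mx2 a b 0 d) z = act sigma g (act sigma (mx2 a b 0 d) z).
  apply/funext => i; have := jfac_neq0 _ _ _ sigma g _ i hz' dg0.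
  have dC := sigmaC_neq0 _ i dn0.
  rewrite [RHS]actE [LHS]actE /jfac acE.
  rewrite [X in X *m _]mx2_eta mulmx2 !mx2E !mulr0 !addr0 !rmorphD !rmorphM/=.
  set u := (_ * z i + (sigma i b)%:C) / _; set j := _ * u + _ => j0.
  rewrite (_ : _ * _ * z i + (_ * _ + (sigma i (g 1 1))%:C * _) = j * (sigma i d)%:C);
    last by rewrite /j /u; field.
  rewrite (_ : _ * _ * z i + _ =
    ((sigma i (g 0 0))%:C * u + (sigma i (g 0 1))%:C) * (sigma i d)%:C);
    last by rewrite /u; field.
  by rewrite -mulf_div divff// mulr1.
by rewrite invfM mulrA.
Qed.

Lemma pterm_translate k mu z g h : invdiff sigma mu -> Hn z -> \det g != 0 -> NGamma h ->
  pterm sigma k mu z (h *m g) = pterm sigma k mu z g.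
Proof.
move=> hmu hz dg /NGammaP[b Ob ->]; rewrite pterm_upper_left ?oner_neq0//.
have [m hm] := hmu b Ob.
rewrite !divr1 hm e1_int !mulr1 /uppfac big1 ?invr1 ?mul1r// => i _.
by rewrite rmorph1 expr1n.
Qed.

Hypothesis n_gt0 : (0 < n)%N.
Hypothesis dimF : \dim (fullv : {vspace F}) = n.
Hypothesis sigma_inj : forall i j, (forall x, sigma i x = sigma j x) -> i = j.

(** This is [sum_double_cosets] for the terms of [P_mu]. Along [Gamma b] the inner sums are
    multiples of [P_mu] at the point [b z] and vanish; along [b Gamma] they are the summands of the
    conclusion. *)
Lemma hecke_relation (r : nat) (N : set F) (D : set 'M[F]_2) (bs : seq 'M[F]_2) mu :
  (1 < r)%N -> two_sided_reps _ (Gamma0 N) D bs ->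
  (forall g, D g -> \det g != 0) ->
  (forall b : 'M[F]_2, b \in bs -> [/\ b 1 0 = 0, totpos sigma (b 0 0) & totpos sigma (b 1 1)]) ->
  invdiff sigma mu -> totpos sigma mu -> poincare_vanishes sigma r.*2 N mu ->
  forall z, Hn z -> \sum_(b <- bs) uppfac r.*2 (b 1 1) *
    e1 (trace sigma (mu * b 0 1 / b 1 1))%:C *
    poincare sigma r.*2 N (mu * b 0 0 / b 1 1) z = 0.
Proof.
move=> r1 hreps hD hbs hmu mu0 hP z hz.
have bE (b : 'M[F]_2) : b \in bs -> b = mx2 (b 0 0) (b 0 1) 0 (b 1 1).
  by move=> /hbs[b10 _ _]; rewrite {1}[b]mx2_eta b10.
have dcr C : cosets (Gamma0 N) C -> \det (crep C) = 1.
  by move=> /(coset_crep _ _ _ (Gamma0_ustable _ N))[[]].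
rewrite -(@sum_double_cosets R F _ _ _ (pterm sigma r.*2 mu z) (fun=> 0) _ hreps).
- by rewrite big1.
- by move=> h g Nh /hD dg; exact: pterm_translate.
- move=> b hb; have [_ a0 d0] := hbs b hb; rewrite (bE _ hb).
  have hz' := act_upper_Hn _ (b 0 1) _ z a0 d0 hz.
  have := HasSumZ _ _ _ _ (uppfac r.*2 (b 1 1)) _
    (HasSum_poincare _ _ _ _ n_gt0 dimF sigma_inj r mu _ N r1 hz' mu0).
  rewrite (hP _ hz') mulr0; apply: eq_HasSum => C /dcr dC.
  by rewrite pterm_upper_right.
- move=> b hb; have [_ a0 d0] := hbs b hb; rewrite {1}(bE _ hb).
  have mu0' : totpos sigma (mu * b 0 0 / b 1 1).
    by apply: totposM; [exact: totposM|exact: totposV].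
  have := HasSumZ _ _ _ _
    (uppfac r.*2 (b 1 1) * e1 (trace sigma (mu * b 0 1 / b 1 1))%:C) _
    (HasSum_poincare _ _ _ _ n_gt0 dimF sigma_inj r _ _ N r1 hz mu0').
  apply: eq_HasSum => C /dcr dC; rewrite pterm_upper_left ?dC ?oner_neq0//.
  exact: totpos_neq0 (Ordinal n_gt0) _ d0.
Qed.

End HeckeTerms.

(** * Representatives for matrices of unit and of prime determinant *)

Section HeckeRepresentatives.
Variable F : fieldExtType rat.
Local Notation O := (@Ointeg F).
Implicit Types (a b c d e p : F) (g h x : 'M[F]_2).
Variable N : set F.
Hypothesis idealN : int_ideal N.

Let NO c : N c -> O c. Proof. by case: idealN => h _ _ _; exact: h. Qed.
Let ND c d : N c -> N d -> N (c + d). Proof. by case: idealN => _ _ h _; exact: h. Qed.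
Let NM a c : O a -> N c -> N (a * c). Proof. by case: idealN => _ _ _ h; exact: h. Qed.

Definition Delta0 e : set 'M[F]_2 :=
  [set g | [/\ [/\ O (g 0 0), O (g 0 1), O (g 1 0) & O (g 1 1)],
      g 0 0 * g 1 1 - g 0 1 * g 1 0 = e & N (g 1 0)]].

Lemma Delta0_mx2 e a b c d : Delta0 e (mx2 a b c d) <->
  [/\ [/\ O a, O b, O c & O d], a * d - b * c = e & N c].
Proof. by rewrite /Delta0/= !mx2E. Qed.

Lemma Delta0_ustable e : ustable (Delta0 e).
Proof.
move=> h g /NGammaP[b Ob ->]; rewrite [g]mx2_eta mulmx2.
move=> /Delta0_mx2[[Oa Ob' Oc Od] d1 Nc]; apply/Delta0_mx2.
rewrite !mul0r !mul1r !add0r; split => //; last by rewrite -d1; ring.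
by split => //; apply: OintegD => //; exact: OintegM.
Qed.

Lemma Delta0_mul_upper e g a b d : O a -> O b -> O d -> a * d = e -> Gamma0 N g ->
  Delta0 e (g *m mx2 a b 0 d) /\ Delta0 e (mx2 a b 0 d *m g).
Proof.
move=> Oa Ob Od <-; rewrite [g]mx2_eta => /Gamma0_mx2.
move: (g 0 0) (g 0 1) (g 1 0) (g 1 1) => a1 b1 c1 d1 [[Oa1 Ob1 Oc1 Od1] e1 Nc1].
have eD : a * d = a * d * (a1 * d1 - b1 * c1) by rewrite e1 mulr1.
rewrite !mulmx2; split; apply/Delta0_mx2.
  split; [by split; apply: OintegD; apply: OintegM => //; exact: Ointeg0|by rewrite eD; ring|by rewrite mulr0 addr0 mulrC; exact: NM].
split; [by split; apply: OintegD; apply: OintegM => //; exact: Ointeg0|by rewrite eD; ring|by rewrite mul0r add0r; exact: NM].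
Qed.

Lemma Gamma0M g h : Gamma0 N g -> Gamma0 N h -> Gamma0 N (g *m h).
Proof.
rewrite [g]mx2_eta [h]mx2_eta mulmx2 => /Gamma0_mx2[[Oa Ob Oc Od] d1 Nc].
move=> /Gamma0_mx2[[Oa' Ob' Oc' Od'] d1' Nc']; apply/Gamma0_mx2; split.
- by split; apply: OintegD; exact: OintegM.
- transitivity ((g 0 0 * g 1 1 - g 0 1 * g 1 0) * (h 0 0 * h 1 1 - h 0 1 * h 1 0)).
    by ring.
  by rewrite d1 d1' mulr1.
- by apply: ND; [rewrite mulrC|]; exact: NM.
Qed.

Lemma Gamma0V g : Gamma0 N g ->
  exists h, [/\ Gamma0 N h, h *m g = 1%:M & g *m h = 1%:M].
Proof.
move=> /Gamma0P; have := mx2_eta _ g.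
move: (g 0 0) (g 0 1) (g 1 0) (g 1 1) => a b c d -> [[Oa Ob Oc Od] d1 Nc].
exists (mx2 d (- b) (- c) a); split.
- apply/Gamma0_mx2; split; [split; try exact: OintegN|rewrite -d1; ring|] => //.
  by rewrite -mulN1r; apply: NM => //; apply: OintegN; exact: Ointeg1.
- rewrite mulmx2 [RHS]mx2_eta !mxE/=; congr mx2; rewrite -?d1; ring.
- rewrite mulmx2 [RHS]mx2_eta !mxE/=; congr mx2; rewrite -?d1; ring.
Qed.

(** Since [Gamma0 N] is a group and the [b] are invertible over [F], each condition on two group
    elements reduces to one on a quotient of the two. *)
Lemma two_sided_repsI e (bs : seq 'M[F]_2) : e != 0 -> uniq bs ->
  (forall b : 'M[F]_2, b \in bs -> exists a u d, [/\ b = mx2 a u 0 d, O a, O u, O d & a * d = e]) ->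
  (forall g (b b' : 'M[F]_2), Gamma0 N g -> b \in bs -> b' \in bs -> g *m b = b' -> b = b') ->
  (forall x, Delta0 e x -> exists g (b : 'M[F]_2), [/\ Gamma0 N g, b \in bs & x = g *m b]) ->
  (forall t g (b b' : 'M[F]_2), O t -> Gamma0 N g -> b \in bs -> b' \in bs ->
     mx2 1 t 0 1 *m b = b' *m g -> NGamma g /\ (g = 1%:M -> b = b')) ->
  (forall x, Delta0 e x -> exists2 g, Gamma0 N g & forall t, O t ->
     exists s (b : 'M[F]_2), [/\ O s, b \in bs & x = mx2 1 s 0 1 *m b *m (mx2 1 t 0 1 *m g)]) ->
  two_sided_reps F (Gamma0 N) (Delta0 e) bs.
Proof.
move=> e0 ubs hb h1 h2 h3 h4; split => //.
- exact: Gamma0_ustable.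
- exact: Delta0_ustable.
- by move=> g b Gg /hb[a [u [d [-> Oa Ou Od ade]]]]; exact: Delta0_mul_upper.
- move=> g g' b b' Gg Gg' hbb hbb' eq.
  have [k [Gk kg' g'k]] := Gamma0V _ Gg'.
  have ebb' : b = b'.
    apply: (h1 (k *m g)) => //; first exact: Gamma0M.
    by rewrite -mulmxA eq mulmxA kg' mul1mx.
  split => //; have bu : b \in unitmx.
    have [a [u [d [-> _ _ _ ade]]]] := hb _ hbb.
    by rewrite unitmxE det_mx2 mulr0 subr0 ade unitfE.
  by rewrite -(mulmxK bu g) eq -ebb' mulmxK.
- move=> h b b' g g' /NGammaP[t Ot ->] hbb hbb' Gg Gg' eq.
  have [k [Gk kg gk]] := Gamma0V _ Gg.
  have [] := h3 t (g' *m k) b b' Ot (Gamma0M _ _ Gg' Gk) hbb hbb'.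
    by rewrite mulmxA -eq -(mulmxA _ g k) gk mulmx1.
  move=> Nh hb1; split; last by move=> eg; apply: hb1; rewrite -eg gk.
  by rewrite -(ucosetM _ g _ Nh) -mulmxA kg mulmx1.
- move=> x /h4[g Gg hg]; exists g => // _ [_ /NGammaP[t Ot ->] <-].
  have [s [b [Os hbb ->]]] := hg t Ot.
  by exists (mx2 1 s 0 1), b; split => //; apply/NGammaP; exists s.
Qed.

(** A unit determinant leaves a single class: [diag(e, 1)] splits off on either side with an
    integral quotient. *)
Lemma unit_reps e : O e -> O e^-1 -> e != 0 ->
  two_sided_reps F (Gamma0 N) (Delta0 e) [:: mx2 e 0 0 1].
Proof.
move=> Oe Oe1 e0; apply: two_sided_repsI => //.
- move=> b; rewrite inE => /eqP ->; exists e, 0, 1.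
  by split; rewrite ?mulr1//; [exact: Ointeg0|exact: Ointeg1].
- by move=> g b b' _; rewrite !inE => /eqP-> /eqP->.
- move=> x; rewrite [x]mx2_eta => /Delta0_mx2.
  move: (x 0 0) (x 0 1) (x 1 0) (x 1 1) => a b c d [[Oa Ob Oc Od] d1 Nc].
  exists (mx2 (e^-1 * a) b (e^-1 * c) d), (mx2 e 0 0 1); split; rewrite ?mem_head//.
    apply/Gamma0_mx2; split; [by split => //; apply: OintegM| |exact: NM].
    by apply: (mulfI e0); rewrite mulr1 -[RHS]d1; field.
  by rewrite mulmx2; congr mx2; field.
- move=> t g b b' Ot Gg; rewrite !inE => /eqP-> /eqP-> eq; split => //.
  apply/NGammaP; exists (e^-1 * t); first exact: OintegM.
  move: eq; rewrite [g]mx2_eta !mulmx2 => /mx2_inj[h1 h2 h3 h4]; congr mx2.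
  + by apply: (mulfI e0); move: h1; rewrite !mul0r !mulr0 !addr0 mulr1 mul1r => <-.
  + apply: (mulfI e0); move: h2; rewrite !(mul0r, mulr0, addr0, add0r, mulr1) => <-.
    by field.
  + by move: h3; rewrite !(mul0r, mulr0, addr0, add0r, mulr1, mul1r).
  + by move: h4; rewrite !(mul0r, mulr0, addr0, add0r, mulr1, mul1r).
- move=> x; rewrite [x]mx2_eta => /Delta0_mx2.
  move: (x 0 0) (x 0 1) (x 1 0) (x 1 1) => a b c d [[Oa Ob Oc Od] d1 Nc].
  exists (mx2 (e^-1 * a) (e^-1 * b) c d).
    apply/Gamma0_mx2; split; [by split => //; apply: OintegM| |by []].
    by apply: (mulfI e0); rewrite mulr1 -[RHS]d1; field.
  move=> t Ot; exists (- (e * t)), (mx2 e 0 0 1); split; rewrite ?mem_head//.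
    by apply: OintegN; exact: OintegM.
  by rewrite !mulmx2; congr mx2; field.
Qed.

(** As [(p)] is maximal, the first column of a matrix of determinant [p] is either divisible by [p]
    or unimodular, which selects [diag(p, 1)] or some [(1 r; 0 p)] on the right. The bottom row
    plays the same part on the left, with the two cases exchanged. *)
Lemma prime_reps p (rs : seq F) : O p -> p != 0 -> ~ principal p 1 ->
  (forall I : set F, int_ideal I -> I p -> I 1 \/ I `<=` principal p) ->
  (exists2 u, O u & N (1 - p * u)) -> uniq rs -> {in rs, forall b, O b} ->
  (forall x : F, O x -> exists b, b \in rs /\ exists2 y, O y & x = b + p * y) ->
  (forall b b' y, b \in rs -> b' \in rs -> O y -> b' = b + p * y -> b' = b) ->
  two_sided_reps F (Gamma0 N) (Delta0 p) (mx2 p 0 0 1 :: [seq mx2 1 b 0 p | b <- rs]).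
Proof.
move=> Op p0 np1 pmax [u Ou Nu] urs Ors rs_surj rs_inj.
have O0 := Ointeg0 F; have O1 := Ointeg1 F.
have np y : O y -> 1 != p * y by move=> Oy; apply/eqP => h; apply: np1; exists y.
(* The ideal [(a, b)] contains [p] and is not inside [(p)], so by [pmax] it contains 1. *)
have bez a b : O a -> O b -> ~ (principal p a /\ principal p b) ->
    (exists s t, [/\ O s, O t & p = a * s + b * t]) ->
    exists s t, [/\ O s, O t & a * s + b * t = 1].
  move=> Oa Ob nab hp.
  pose I : set F := [set x | exists s t, [/\ O s, O t & x = a * s + b * t]].
  have Ia : I a by exists 1, 0; split => //; ring.
  have Ib : I b by exists 0, 1; split => //; ring.
  have [||[s [t [Os Ot e1]]]|hI] := pmax I.
  - split.
    + by move=> _ [s [t [Os Ot ->]]]; apply: OintegD; exact: OintegM.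
    + by exists 0, 0; split => //; ring.
    + move=> _ _ [s [t [Os Ot ->]]] [s' [t' [Os' Ot' ->]]].
      by exists (s + s'), (t + t'); split; [exact: OintegD|exact: OintegD|ring].
    + move=> q _ Oq [s [t [Os Ot ->]]].
      by exists (q * s), (q * t); split; [exact: OintegM|exact: OintegM|ring].
  - exact: hp.
  - by exists s, t.
  - by case: nab; split; apply: hI.
(* [p] is invertible modulo [N], with inverse [u]. *)
have Ndiv c : O c -> N (p * c) -> N c.
  move=> Oc Npc; have -> : c = u * (p * c) + c * (1 - p * u) by ring.
  by apply: ND; exact: NM.
apply: two_sided_repsI => //.
- rewrite /= map_inj_uniq ?urs ?andbT; last by move=> b b' /mx2_inj[].
  apply/mapP => -[b _ /mx2_inj[e _ _ _]].
  by have := np 1 O1; rewrite mulr1 e eqxx.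
- move=> b; rewrite inE => /orP[/eqP->|/mapP[r hr ->]].
    by exists p, 0, 1; split; rewrite ?mulr1.
  by exists 1, r, p; split; rewrite ?mul1r//; exact: Ors.
- move=> g b b'; rewrite [g]mx2_eta => /Gamma0_mx2.
  move: (g 0 0) (g 0 1) (g 1 0) (g 1 1) => a1 b1 c1 d1 [[Oa1 Ob1 Oc1 Od1] e1 Nc1].
  rewrite !inE => /orP[/eqP->|/mapP[r hr ->]] /orP[/eqP->|/mapP[r' hr' ->]] //.
  + rewrite mulmx2 => /mx2_inj[h1 _ _ _]; have := np a1 Oa1.
    by rewrite -h1 mulr0 addr0 mulrC eqxx.
  + rewrite mulmx2 => /mx2_inj[_ _ h3 h4].
    move: h3; rewrite mulr0 addr0 mulr1 => h3; move: h4; rewrite h3 mul0r add0r => h4.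
    by have := np d1 Od1; rewrite -h4 mulrC eqxx.
  + rewrite mulmx2 => /mx2_inj[h1 h2 _ _]; congr mx2.
    apply/esym; apply: (rs_inj r r' b1) => //; rewrite -h2.
    by move: h1; rewrite mulr0 addr0 mulr1 => ->; ring.
- move=> x; rewrite [x]mx2_eta => /Delta0_mx2.
  move: (x 0 0) (x 0 1) (x 1 0) (x 1 1) => a b c d [[Oa Ob Oc Od] e1 Nc].
  have [[[a' Oa' ha] [c' Oc' hc]]|hac] := EM (principal p a /\ principal p c).
    exists (mx2 a' b c' d), (mx2 p 0 0 1); split; rewrite ?mem_head//.
      apply/Gamma0_mx2; split => //; last by apply: Ndiv; rewrite // -hc.
      by apply: (mulfI p0); rewrite mulr1 -[RHS]e1 ha hc; ring.
    by rewrite mulmx2 ha hc; congr mx2; ring.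
  have [s [t [Os Ot e2]]] : exists s t, [/\ O s, O t & a * s + c * t = 1].
    by apply: bez => //; exists d, (- b); split => //; [exact: OintegN|rewrite -e1; ring].
  (* Modulo [p] the second column is [b s + d t] times the first, by the Bezout relation and the
     determinant. *)
  have [r [hr [w Ow hw]]] := rs_surj (b * s + d * t) (OintegD _ _ _ (OintegM _ _ _ Ob Os) (OintegM _ _ _ Od Ot)).
  have hb : b - a * r = p * (a * w - t).
    have -> : r = b * s + d * t - p * w by rewrite hw; ring.
    transitivity (b * (a * s + c * t) - a * (b * s + d * t - p * w)); first by rewrite e2 mulr1.
    rewrite -e1; ring.
  have hd : d - c * r = p * (c * w + s).
    have -> : r = b * s + d * t - p * w by rewrite hw; ring.
    transitivity (d * (a * s + c * t) - c * (b * s + d * t - p * w)); first by rewrite e2 mulr1.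
    rewrite -e1; ring.
  exists (mx2 a (a * w - t) c (c * w + s)), (mx2 1 r 0 p); split.
  + apply/Gamma0_mx2; split => //.
      by split => //; [apply: OintegB|apply: OintegD] => //; exact: OintegM.
    by rewrite -e2; ring.
  + by rewrite inE; apply/orP; right; apply/mapP; exists r.
  + rewrite mulmx2; congr mx2; [ring| |ring|].
      by rewrite [X in _ + X]mulrC -hb; ring.
    by rewrite [X in _ + X]mulrC -hd; ring.
- move=> t g b b' Ot; rewrite [g]mx2_eta => /Gamma0_mx2.
  move: (g 0 0) (g 0 1) (g 1 0) (g 1 1) => a1 b1 c1 d1 [[Oa1 Ob1 Oc1 Od1] e1 Nc1].
  rewrite !inE => /orP[/eqP->|/mapP[r hr ->]] /orP[/eqP->|/mapP[r' hr' ->]] //.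
  + rewrite !mulmx2 => /mx2_inj[h1 h2 h3 h4]; split => //.
    have ea : a1 = 1 by apply: (mulfI p0); rewrite -[LHS]addr0 -[in LHS](mul0r c1) -h1; ring.
    have ec : c1 = 0 by rewrite -[LHS]add0r -[in LHS](mul0r a1) -[in LHS](mul1r c1) -h3; ring.
    have ed : d1 = 1 by rewrite -[LHS]add0r -[in LHS](mul0r b1) -[in LHS](mul1r d1) -h4; ring.
    by apply/NGammaP; exists b1 => //; rewrite ea ec ed.
  + rewrite !mulmx2 => /mx2_inj[_ _ _ h4]; have := np d1 Od1.
    by move: h4; rewrite !mul0r !mul1r !add0r => ->; rewrite eqxx.
  + rewrite !mulmx2 => /mx2_inj[h1 _ _ _]; have := np a1 Oa1.
    by move: h1; rewrite !mul0r !mulr0 !mul1r !addr0 => ->; rewrite eqxx.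
  + rewrite !mulmx2 => /mx2_inj[h1 h2 h3 h4].
    have ec : c1 = 0 by apply: (mulfI p0); rewrite -[LHS]add0r -[in LHS](mul0r a1) -h3; ring.
    have ed : d1 = 1 by apply: (mulfI p0); rewrite -[LHS]add0r -[in LHS](mul0r b1) -h4; ring.
    have ea : a1 = 1 by move: h1; rewrite ec => h1; rewrite -[LHS]mul1r -[LHS]addr0 -[in LHS](mulr0 r') -h1; ring.
    split; first by apply/NGammaP; exists b1 => //; rewrite ea ec ed.
    rewrite [1%:M]mx2_eta => /mx2_inj[_ eb _ _]; congr mx2.
    apply/esym; apply: (rs_inj r r' t) => //.
    have {}eb : b1 = 0 by rewrite eb mxE.
    by have -> : r' = 1 * b1 + r' * d1; [rewrite eb ed|rewrite -h2]; ring.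
- move=> x; rewrite [x]mx2_eta => /Delta0_mx2.
  move: (x 0 0) (x 0 1) (x 1 0) (x 1 1) => a b c d [[Oa Ob Oc Od] e1 Nc].
  have [[[c' Oc' hc] [d' Od' hd]]|hcd] := EM (principal p c /\ principal p d).
    exists (mx2 a b c' d').
      apply/Gamma0_mx2; split => //; last by apply: Ndiv; rewrite // -hc.
      by apply: (mulfI p0); rewrite mulr1 -[RHS]e1 hc hd; ring.
    (* The choice [r + p w = - t] cancels the translation [t] of the representative. *)
    move=> t Ot; have [r [hr [w Ow hw]]] := rs_surj (- t) (OintegN _ _ Ot).
    exists w, (mx2 1 r 0 p); split => //; first by rewrite inE; apply/orP; right; apply/mapP; exists r.
    have -> : r = - t - p * w by rewrite hw; ring.
    by rewrite !mulmx2 hc hd; congr mx2; ring.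
  have [s [t [Os Ot e2]]] : exists s t, [/\ O s, O t & c * s + d * t = 1].
    by apply: bez => //; exists (- b), a; split => //; [exact: OintegN|rewrite -e1; ring].
  (* The unimodular row [(c, d)] is completed to determinant 1. The top row of [x] is then [p] times
     the new top row plus [a s + b t] times [(c, d)]. *)
  exists (mx2 t (- s) c d).
    apply/Gamma0_mx2; split => //; first by split => //; exact: OintegN.
    by rewrite -e2; ring.
  move=> t' Ot'; exists (a * s + b * t - p * t'), (mx2 p 0 0 1); split.
  + by apply: OintegB; [apply: OintegD|]; exact: OintegM.
  + by rewrite mem_head.
  + rewrite !mulmx2; congr mx2; [| |ring|ring].
      transitivity (a * (c * s + d * t)); first by rewrite e2 mulr1.
      rewrite -[in RHS]e1; ring.
    transitivity (b * (c * s + d * t)); first by rewrite e2 mulr1.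
    rewrite -[in RHS]e1; ring.
Qed.

End HeckeRepresentatives.

(** * Prime factorization, character sums and relations between vanishing series *)

Section Recursion.
Variables (R : realType) (F : fieldExtType rat) (n : nat).
Variable sigma : 'I_n -> {rmorphism F -> R}.
Hypothesis n_gt0 : (0 < n)%N.
Hypothesis dimF : \dim (fullv : {vspace F}) = n.
Hypothesis sigma_inj : forall i j, (forall x, sigma i x = sigma j x) -> i = j.
Hypothesis hclass : narrow_class_number_one sigma.
Local Notation O := (@Ointeg F).
Implicit Types (a b c p q x y mu : F).

Let tp0 x : totpos sigma x -> x != 0. Proof. exact: (totpos_neq0 _ _ _ sigma (Ordinal n_gt0)). Qed.

Lemma int_ideal2 a b : O a -> O b ->
  int_ideal [set x | exists s t, [/\ O s, O t & x = a * s + b * t]].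
Proof.
have O0 := Ointeg0 F.
move=> Oa Ob; split.
- by move=> _ [s [t [Os Ot ->]]]; apply: OintegD; exact: OintegM.
- by exists 0, 0; split => //; ring.
- move=> _ _ [s [t [Os Ot ->]]] [s' [t' [Os' Ot' ->]]].
  by exists (s + s'), (t + t'); split; [exact: OintegD|exact: OintegD|ring].
- move=> q _ Oq [s [t [Os Ot ->]]].
  by exists (q * s), (q * t); split; [exact: OintegM|exact: OintegM|ring].
Qed.

(** A generator [g] of [I] divides [p]. By primality [p] divides [g], so that [I] lies in [(p)], or
    [p] divides the cofactor, so that [g] is a unit. *)
Lemma prime_maximal p (I : set F) : prime_elt p -> int_ideal I -> I p ->
  I 1 \/ I `<=` principal p.
Proof.
move=> [Op p0 _ pp] idI Ip; have [IO _ _ IM] := idI.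
have [g [_ eI]] := hclass _ idI (ex_intro2 _ _ p Ip p0).
have Ig : I g by rewrite eI; exists 1; [exact: Ointeg1|rewrite mulr1].
have [h Oh hp] : principal g p by rewrite -eI.
have [|[y Oy hy]|[y Oy hy]] := pp g h (IO _ Ig) Oh.
- by exists 1; [exact: Ointeg1|rewrite mulr1 hp].
- right; rewrite eI => _ [x Ox ->]; exists (y * x); first exact: OintegM.
  by rewrite hy mulrA.
- left; have -> : 1 = y * g; last exact: IM.
  by apply: (mulfI p0); rewrite mulr1 {1}hp hy; ring.
Qed.

Definition embnorm x : R := \prod_(i < n) sigma i x.

Lemma embnormM x y : embnorm (x * y) = embnorm x * embnorm y.
Proof. by rewrite /embnorm -big_split/=; apply: eq_bigr => i _; rewrite rmorphM. Qed.

Lemma embnorm_ge1 x : O x -> totpos sigma x -> 1 <= embnorm x.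
Proof.
move=> Ox x0; have [m hm] := norm_int _ _ _ sigma dimF sigma_inj x Ox.
have : 0 < embnorm x by apply: prodr_gt0 => i _; exact: x0.
by rewrite /embnorm hm -[1]/(1%:~R) ler_int ltr0z; lia.
Qed.

Lemma embnorm_nonunit x : O x -> totpos sigma x -> ~ O x^-1 -> 2 <= embnorm x.
Proof.
move=> Ox x0 nu; have [m hm] := norm_int _ _ _ sigma dimF sigma_inj x Ox.
have := embnorm_ge1 x Ox x0; rewrite /embnorm hm -[1]/(1%:~R) -[2]/(2%:~R) !ler_int => m1.
have : m != 1 by apply: contra_not_neq nu => m1'; apply: (norm_unit _ _ _ sigma n_gt0 dimF sigma_inj) => //; rewrite hm m1'.
lia.
Qed.

(** A generator [g] of [(a, p)] divides [p], so [g] or its cofactor is a unit; in the first case [p]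
    divides [b], in the second [p] divides [a]. Narrow class number one makes [g] totally positive,
    so factorizations into totally positive elements suffice. *)
Lemma irreducible_prime p : O p -> totpos sigma p -> ~ O p^-1 ->
  (forall g h, O g -> O h -> totpos sigma g -> totpos sigma h -> p = g * h ->
     O g^-1 \/ O h^-1) -> prime_elt p.
Proof.
move=> Op pos nu irr; have p0 := tp0 _ pos; split => //.
  by move=> [y Oy e]; apply: nu; have -> : p^-1 = y by apply: (mulfI p0); rewrite mulfV.
move=> a b Oa Ob [y Oy hab].
pose I := [set x | exists s t, [/\ O s, O t & x = a * s + p * t]].
have idI : int_ideal I by exact: int_ideal2.
have O0 := Ointeg0 F; have O1 := Ointeg1 F.
have Ip : I p by exists 0, 1; split => //; ring.
have Ia : I a by exists 1, 0; split => //; ring.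
have [g [g_pos eI]] := hclass _ idI (ex_intro2 _ _ p Ip p0).
have g0 := tp0 _ g_pos.
have Ig : I g by rewrite eI; exists 1 => //; rewrite mulr1.
have Og : O g by case: idI => h _ _ _; exact: h.
have [h Oh hp] : principal g p by rewrite -eI.
have h_pos : totpos sigma h.
  have -> : h = p * g^-1 by rewrite hp mulrAC mulfV// mul1r.
  by apply: totposM => //; exact: totposV.
have [Og1|Oh1] := irr g h Og Oh g_pos h_pos hp.
  have : I 1 by rewrite eI; exists g^-1; rewrite ?mulfV.
  move=> [s [t [Os Ot e1]]]; right; exists (y * s + b * t).
    by apply: OintegD; exact: OintegM.
  by rewrite mulrDr mulrA -hab -[LHS]mulr1 e1; ring.
have [z Oz hz] : principal g a by rewrite -eI.
left; exists (h^-1 * z); first exact: OintegM.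
by rewrite hp hz mulrA mulfK// tp0.
Qed.

(** Induction on a natural number bounding the norm: when [a] splits into two nonunits, the factor
    [g] has at most half its norm. *)
Lemma prime_divisor a : O a -> totpos sigma a -> ~ O a^-1 ->
  exists q b, [/\ prime_elt q, totpos sigma q, O b & a = q * b].
Proof.
have [M] : exists M : nat, embnorm a <= M%:R.
  exists (Num.bound `|embnorm a|); apply: (le_trans (ler_norm _)).
  by apply/ltW/archi_boundP.
elim: M a => [|M IH] a hM Oa a_pos nu.
  by have := embnorm_ge1 a Oa a_pos; rewrite leNgt (le_lt_trans hM).
have [irr|] := pselect (forall g h, O g -> O h -> totpos sigma g -> totpos sigma h ->
    a = g * h -> O g^-1 \/ O h^-1).
  exists a, 1; split; rewrite ?mulr1//; [exact: irreducible_prime|exact: Ointeg1].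
move=> /existsNP[g] /existsNP[h] /not_implyP[Og] /not_implyP[Oh] /not_implyP[g_pos].
move=> /not_implyP[h_pos] /not_implyP[e] /not_orP[nug nuh].
have [|q [b [qp q_pos Ob gq]]] := IH g _ Og g_pos nug.
  have := embnorm_nonunit h Oh h_pos nuh; have := embnorm_ge1 g Og g_pos.
  move: hM; rewrite e embnormM -natr1; nra.
exists q, (b * h); split => //; first exact: OintegM.
by rewrite e gq mulrA.
Qed.

Lemma invdiffM mu a : invdiff sigma mu -> O a -> invdiff sigma (mu * a).
Proof. by move=> hmu Oa y Oy; rewrite -mulrA; apply: hmu; exact: OintegM. Qed.

(** If [mu / p] is in the inverse different, every term is 1 and the sum counts residues. Otherwise
    some [y] has character value other than 1; translation by [y] permutes the residues and
    multiplies the sum by that value. *)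
Lemma residue_character_sum mu p (rs : seq F) : p != 0 -> invdiff sigma mu -> uniq rs ->
  {in rs, forall b, O b} ->
  (forall x, O x -> exists b, b \in rs /\ exists2 y, O y & x = b + p * y) ->
  (forall b b' y, b \in rs -> b' \in rs -> O y -> b' = b + p * y -> b' = b) ->
  (invdiff sigma (mu / p) ->
     \sum_(b <- rs) e1 (trace sigma (mu * b / p))%:C != 0 :> R[i]) /\
  (~ invdiff sigma (mu / p) ->
     \sum_(b <- rs) e1 (trace sigma (mu * b / p))%:C = 0 :> R[i]).
Proof.
move=> p0 hmu urs Ors rs_surj rs_inj.
have trD x y : trace sigma (x + y) = trace sigma x + trace sigma y.
  by rewrite /trace -big_split/=; apply: eq_bigr => i _; rewrite rmorphD.
split=> [hmup|].
  rewrite big_seq (eq_bigr (fun=> 1)); last first.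
    move=> b /Ors Ob; have [m hm] := hmup b Ob.
    by rewrite mulrAC hm e1_int.
  rewrite -big_seq big_const_seq count_predT iter_addr_0 pnatr_eq0 size_eq0.
  by have [b [hb _]] := rs_surj 0 (Ointeg0 F); apply: contraTneq hb => ->.
move=> /existsNP[y] /not_implyP[Oy ny].
pose chi x : R[i] := e1 (trace sigma (mu * x / p))%:C.
have chiD x x' : chi (x + x') = chi x * chi x'.
  by rewrite /chi mulrDr mulrDl trD rmorphD e1D.
have chi_p w : O w -> chi (p * w) = 1.
  move=> Ow; have [m hm] := hmu w Ow; rewrite /chi.
  have -> : mu * (p * w) / p = mu * w by field.
  by rewrite hm e1_int.
have chi_y : chi y != 1.
  apply/eqP => /e1_eq1[m hm]; apply: ny; exists m; rewrite -hm; congr trace; ring.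
(* [f b] is the representative of [b + y]; outside [rs] the value 0 is a placeholder. *)
have /choice[f hf] : forall b, exists c, b \in rs ->
    c \in rs /\ exists2 w, O w & b + y = c + p * w.
  move=> b; have [hb|hb] := boolP (b \in rs); last by exists 0.
  have [c [hc hw]] := rs_surj (b + y) (OintegD _ _ _ (Ors _ hb) Oy).
  by exists c.
have f_inj : {in rs &, injective f}.
  move=> b b' hb hb' e; have [hc [w Ow hw]] := hf _ hb; have [hc' [w' Ow' hw']] := hf _ hb'.
  apply/esym/(rs_inj b b' (w' - w)) => //; first exact: OintegB.
  have -> : b' = f b' + p * w' - y by rewrite -hw'; ring.
  have {1}-> : b = f b + p * w - y by rewrite -hw; ring.
  by rewrite e; ring.
have uf : uniq (map f rs) by rewrite map_inj_in_uniq.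
have pf : perm_eq (map f rs) rs.
  apply: uniq_perm => //.
  have sub : {subset map f rs <= rs} by move=> _ /mapP[b hb ->]; case: (hf b hb).
  by have [] := uniq_min_size uf sub; rewrite ?size_map.
have e : chi y * (\sum_(b <- rs) chi b) = \sum_(b <- rs) chi b.
  rewrite -[RHS](perm_big _ pf)/= big_map mulr_sumr big_seq [RHS]big_seq.
  apply: eq_bigr => b hb; have [hc [w Ow hw]] := hf _ hb.
  by rewrite mulrC -chiD hw chiD chi_p// mulr1.
apply/eqP; have /eqP : (chi y - 1) * (\sum_(b <- rs) chi b) = 0.
  by rewrite mulrBl e mul1r subrr.
by rewrite mulf_eq0 subr_eq0 (negbTE chi_y).
Qed.

Variables (r : nat) (N : set F).
Hypothesis r_gt1 : (1 < r)%N.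
Hypothesis idealN : int_ideal N.

Lemma Delta0_det_neq0 e g : e != 0 -> Delta0 F N e g -> \det g != 0.
Proof. by move=> e0 [_ de _]; rewrite det2 de. Qed.

(** With the single representative [diag(e, 1)], the Hecke relation has one term, [P_(mu e)] with
    coefficient 1. *)
Lemma unit_vanishing mu e : O e -> O e^-1 -> totpos sigma e ->
  invdiff sigma mu -> totpos sigma mu ->
  poincare_vanishes sigma r.*2 N mu -> poincare_vanishes sigma r.*2 N (mu * e).
Proof.
move=> Oe Oe1 e_pos hmu mu_pos hP z hz; have e0 := tp0 _ e_pos.
have := hecke_relation _ _ _ sigma n_gt0 dimF sigma_inj r N _ _ mu r_gt1
  (unit_reps F N idealN e Oe Oe1 e0) (fun g => Delta0_det_neq0 e g e0) _ hmu mu_pos hP z hz.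
rewrite big_seq1 !mx2E !divr1 mulr0 => H.
have {}H : poincare sigma r.*2 N (mu * e) z = 0; last by [].
apply: etrans (H _).
  rewrite /uppfac big1; last by move=> i _; rewrite rmorph1 expr1n.
  rewrite /trace big1; last by move=> i _; rewrite rmorph0.
  by rewrite (e1_int _ 0) invr1 !mul1r.
move=> b; rewrite inE => /eqP->; rewrite !mx2E; split => // i.
by rewrite rmorph1.
Qed.

(** When [P_mu] vanishes, the Hecke relation reads [P_(mu p) + N(p)^-k S P_(mu / p) = 0] with [S]
    the sum evaluated in [residue_character_sum]; membership of [mu / p] in the inverse different
    decides whether [S] is zero. *)
Lemma prime_vanishing mu p : prime_elt p -> totpos sigma p ->
  (exists2 u, O u & N (1 - p * u)) -> invdiff sigma mu -> totpos sigma mu ->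
  poincare_vanishes sigma r.*2 N mu ->
  (~ invdiff sigma (mu / p) -> poincare_vanishes sigma r.*2 N (mu * p)) /\
  (invdiff sigma (mu / p) ->
    poincare_vanishes sigma r.*2 N (mu * p) <-> poincare_vanishes sigma r.*2 N (mu / p)).
Proof.
move=> pp p_pos copr hmu mu_pos hP; have [Op p0 np1 _] := pp.
have [rs [urs Ors rs_surj rs_inj]] :=
  residue_system _ _ _ sigma n_gt0 dimF sigma_inj p Op p0.
have hreps := prime_reps F N idealN p rs Op p0 np1 (fun I => prime_maximal p I pp) copr
  urs Ors rs_surj rs_inj.
have [cs1 cs0] := residue_character_sum mu p rs p0 hmu urs Ors rs_surj rs_inj.
set S := \sum_(b <- rs) _ in cs1 cs0.
have key z : Hn z -> poincare sigma r.*2 N (mu * p) z +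
    uppfac _ _ _ sigma r.*2 p * S * poincare sigma r.*2 N (mu / p) z = 0.
  move=> hz.
  have := hecke_relation _ _ _ sigma n_gt0 dimF sigma_inj r N _ _ mu r_gt1
    hreps (fun g => Delta0_det_neq0 p g p0) _ hmu mu_pos hP z hz.
  rewrite big_cons big_map !mx2E !divr1 mulr0 => H; apply: etrans (H _).
    congr (_ + _).
      rewrite /uppfac big1; last by move=> i _; rewrite rmorph1 expr1n.
      rewrite /trace big1; last by move=> i _; rewrite rmorph0.
      by rewrite (e1_int _ 0) invr1 !mul1r.
    rewrite /S mulr_sumr mulr_suml; apply: eq_bigr => b _.
    by rewrite !mx2E mulr1.
  move=> b; rewrite inE => /orP[/eqP->|/mapP[c hc ->]]; rewrite !mx2E; split => // i.
    by rewrite rmorph1.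
  by rewrite rmorph1.
split=> [/cs0 S0 z hz|/cs1 S0].
  by have := key z hz; rewrite S0 mulr0 mul0r addr0.
have U0 : uppfac _ _ _ sigma r.*2 p != 0.
  by rewrite invr_eq0; apply/prodf_neq0 => i _; rewrite expf_neq0// sigmaC_neq0.
split=> h z hz; have := key z hz; rewrite (h z hz).
  by move/eqP; rewrite add0r mulf_eq0 mulf_eq0 (negbTE U0) (negbTE S0) => /eqP.
by rewrite mulr0 addr0.
Qed.

End Recursion.

(** * Induction on the norm, powers of a prime, and the theorem *)

Section Vanishing.
Variables (R : realType) (F : fieldExtType rat) (n : nat).
Variable sigma : 'I_n -> {rmorphism F -> R}.
Hypothesis n_gt0 : (0 < n)%N.
Hypothesis dimF : \dim (fullv : {vspace F}) = n.
Hypothesis sigma_inj : forall i j, (forall x, sigma i x = sigma j x) -> i = j.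
Hypothesis hclass : narrow_class_number_one sigma.
Variables (r : nat) (N : set F).
Hypothesis r_gt1 : (1 < r)%N.
Hypothesis idealN : int_ideal N.
Local Notation O := (@Ointeg F).
Local Notation vanishes := (poincare_vanishes sigma r.*2 N).

(** Write [a = q b] with [q] prime. The relation at [mu b] may involve the index [mu b / q]; in that
    case coprimality of [q] to [mu delta] yields [b = q c], and the index is [mu c]. Induction on a
    bound for the norm covers both [b] and [c]. *)
Lemma coprime_vanishing (delta mu a : F) : different sigma delta ->
  O a -> totpos sigma a -> invdiff sigma mu -> totpos sigma mu ->
  (exists s x, [/\ O s, N x & a * s + mu * delta * x = 1]) ->
  vanishes mu -> vanishes (mu * a).
Proof.
move=> hdelta + + hmu mu_pos + hP; have [NO _ _ NM] := idealN.
have Omd : O (mu * delta) by rewrite mulrC; exact: hdelta.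
have [M] : exists M : nat, embnorm _ _ _ sigma a <= M%:R.
  exists (Num.bound `|embnorm _ _ _ sigma a|); apply: (le_trans (ler_norm _)).
  by apply/ltW/archi_boundP.
elim: M a => [|M IH] a hM Oa a_pos [s [x [Os Nx e1]]].
  have := embnorm_ge1 _ _ _ sigma n_gt0 dimF sigma_inj a Oa a_pos.
  by rewrite leNgt (le_lt_trans hM).
have [Oa1|nua] := pselect (O a^-1).
  exact: (unit_vanishing _ _ _ sigma n_gt0 dimF sigma_inj r N r_gt1 idealN).
have [q [b [qp q_pos Ob eab]]] :=
  prime_divisor _ _ _ sigma n_gt0 dimF sigma_inj hclass a Oa a_pos nua.
have [Oq q0 nq1 q_prime] := qp.
have b_pos : totpos sigma b.
  have -> : b = a * q^-1 by rewrite eab mulrAC mulfV// mul1r.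
  by apply: totposM => //; exact: totposV.
have nuq : ~ O q^-1 by move=> Oq1; apply: nq1; exists q^-1; rewrite ?mulfV.
(* [2 N(b) <= N(a) <= M + 1] and [1 <= N(b)] give [N(b) <= M]. *)
have hMb : embnorm _ _ _ sigma b <= M%:R.
  have := embnorm_nonunit _ _ _ sigma n_gt0 dimF sigma_inj q Oq q_pos nuq.
  have := embnorm_ge1 _ _ _ sigma n_gt0 dimF sigma_inj b Ob b_pos.
  by move: hM; rewrite eab embnormM -natr1; nra.
have hPb : vanishes (mu * b).
  apply: IH => //; exists (q * s), x; split => //; first exact: OintegM.
  by rewrite -e1 eab; ring.
have copr : exists2 u, O u & N (1 - q * u).
  exists (b * s); first exact: OintegM.
  have -> : 1 - q * (b * s) = mu * delta * x by rewrite -e1 eab; ring.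
  exact: NM.
have mub_pos : totpos sigma (mu * b) by exact: totposM.
have [h1 h2] := prime_vanishing _ _ _ sigma n_gt0 dimF sigma_inj hclass r N r_gt1 idealN
  (mu * b) q qp q_pos copr (invdiffM _ _ _ sigma _ _ hmu Ob) mub_pos hPb.
have -> : mu * a = mu * b * q by rewrite eab; ring.
have [hq|hq] := pselect (invdiff sigma (mu * b / q)); last exact: h1.
apply/(h2 hq).
(* Integrality of [delta mu b / q] means that [q] divides [mu delta b]. If [q] divided [mu delta],
   the Bezout relation would make it divide 1, so it divides [b]. *)
have Odb : O (delta * (mu * b / q)) by exact: hdelta.
have [|[y Oy hy]|[c Oc hc]] := q_prime (mu * delta) b Omd Ob.
- by exists (delta * (mu * b / q)) => //; field.
- case: nq1; exists (b * s + y * x).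
    by apply: OintegD; apply: OintegM => //; exact: NO.
  by rewrite -e1 eab hy; ring.
- have -> : mu * b / q = mu * c by rewrite hc; field.
  have c_pos : totpos sigma c.
    have -> : c = b * q^-1 by rewrite hc mulrAC mulfV// mul1r.
    by apply: totposM => //; exact: totposV.
  apply: IH => //.
    apply: le_trans hMb; rewrite hc embnormM.
    have := embnorm_ge1 _ _ _ sigma n_gt0 dimF sigma_inj q Oq q_pos.
    by have := embnorm_ge1 _ _ _ sigma n_gt0 dimF sigma_inj c Oc c_pos; nra.
  exists (q * q * s), x; split => //; first by do 2 apply: OintegM => //.
  by rewrite -e1 eab hc; ring.
Qed.

(** The relation at [mu p^(m+1)] links the neighbouring exponents. Dividing by [p] gives [mu p^m],
    still in the inverse different, so the character sum is nonzero. *)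
Lemma prime_power_vanishing (mu p : F) (m : nat) :
  prime_elt p -> totpos sigma p -> (exists2 u, O u & N (1 - p * u)) ->
  invdiff sigma mu -> totpos sigma mu ->
  vanishes (mu * p ^+ m.+1) -> vanishes (mu * p ^+ m.+2) <-> vanishes (mu * p ^+ m).
Proof.
move=> pp p_pos copr hmu mu_pos hP; have [Op p0 _ _] := pp.
have pX_pos j : totpos sigma (p ^+ j) by move=> i; rewrite rmorphXn exprn_gt0// p_pos.
have hX j : invdiff sigma (mu * p ^+ j) by apply: invdiffM => //; exact: OintegX.
have [_] := prime_vanishing _ _ _ sigma n_gt0 dimF sigma_inj hclass r N r_gt1 idealN
  (mu * p ^+ m.+1) p pp p_pos copr (hX m.+1) (totposM _ _ _ _ _ _ mu_pos (pX_pos m.+1)) hP.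
have -> : mu * p ^+ m.+1 * p = mu * p ^+ m.+2 by rewrite -mulrA -exprSr.
have -> : mu * p ^+ m.+1 / p = mu * p ^+ m by rewrite exprSr mulrA mulfK.
by apply.
Qed.

End Vanishing.

Theorem theorem4p6 (R : realType) (F : fieldExtType rat) (n : nat)
  (sigma : 'I_n -> {rmorphism F -> R})
  (hn : (1 < n)%N) (hdim : \dim (fullv : {vspace F}) = n)
  (hsigma : forall i j, (forall x, sigma i x = sigma j x) -> i = j)
  (hclass : narrow_class_number_one sigma)
  (delta : F) (hdelta_pos : totpos sigma delta)
  (hdelta : different sigma = principal delta)
  (k : nat) (hk : (2 < k)%N) (hk_even : ~~ odd k)
  (N : set F) (hN : int_ideal N) (hN0 : nonzero_set N)
  (mu : F) (hmu : invdiff sigma mu) (hmu_pos : totpos sigma mu)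
  (alpha : F) (halpha : Ointeg alpha) (halpha_pos : totpos sigma alpha)
  (p : F) (hp : prime_elt p) (hp_pos : totpos sigma p)
  (hcop : coprime_ideals (principal (alpha * p))
                         [set mu * delta * x | x in N]) :
  (poincare_vanishes sigma k N mu ->
     poincare_vanishes sigma k N (mu * alpha)) /\
  (~ poincare_vanishes sigma k N mu ->
     forall m : nat, (0 < m)%N ->
       ~ poincare_vanishes sigma k N (mu * p ^+ m) \/
       (~ poincare_vanishes sigma k N (mu * p ^+ m.-1) /\
        ~ poincare_vanishes sigma k N (mu * p ^+ m.+1))).
Proof.
have n_gt0 : (0 < n)%N by exact: ltnW.
(* An even [k > 2] is [2 r] with [r >= 2], the range of the convergence bound. *)
have [r -> r1] : exists2 r, k = r.*2 & (1 < r)%N.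
  exists k./2; first by rewrite even_halfK.
  by have := even_halfK hk_even; lia.
have [NO _ _ NM] := hN.
have hd : different sigma delta.
  by rewrite hdelta; exists 1; [exact: Ointeg1|rewrite mulr1].
have [_ [_ [[s Os ->] [x Nx <-] e1]]] := hcop.
have [Op p0 _ _] := hp.
split=> [hP|nP m m_gt0].
  apply: (coprime_vanishing _ _ _ sigma n_gt0 hdim hsigma hclass r N r1 hN delta) => //.
  by exists (p * s), x; split => //; [exact: OintegM|rewrite mulrA].
(* Coprimality of [alpha p] to [mu delta N] provides the inverse [alpha s] of [p] modulo [N]. *)
have copr : exists2 u, Ointeg u & N (1 - p * u).
  exists (alpha * s); first exact: OintegM.
  have -> : 1 - p * (alpha * s) = mu * delta * x by rewrite -e1; ring.
  by apply: NM => //; rewrite mulrC; exact: hd.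
have step j := prime_power_vanishing _ _ _ sigma n_gt0 hdim hsigma hclass r N r1 hN
  mu p j hp hp_pos copr hmu hmu_pos.
(* Two consecutive zeros in the sequence [P_(mu p^j)] would propagate down to [P_mu]. *)
have descent j : poincare_vanishes sigma r.*2 N (mu * p ^+ j) ->
    ~ poincare_vanishes sigma r.*2 N (mu * p ^+ j.+1).
  elim: j => [|j IH] h; first by case: nP; rewrite expr0 mulr1 in h.
  by move=> /(step j h) hj; exact: IH hj h.
case: m m_gt0 => // m _ /=.
have [h|h] := pselect (poincare_vanishes sigma r.*2 N (mu * p ^+ m.+1)); last by left.
have nm : ~ poincare_vanishes sigma r.*2 N (mu * p ^+ m) by move=> /descent; exact.
by right; split => //; move=> /(step m h).
Qed.
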